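(* The following two statements are equivalent: (a) for every finitely generated Coxeter group $W$ and every finitely torsion-generated group $G$ elementarily equivalent to $W$, the group $G$ is a Coxeter group; (b) for every finitely generated irreducible Coxeter group $W$ and every finitely torsion-generated group $G$ elementarily equivalent to $W$, the group $G$ is a Coxeter group.
   Context: A Coxeter group is a group $W$ with a presentation $\langle S\mid (ss')^{m(s,s')}=1\rangle$, $m(s,s')=m(s',s)\in\{1,\dots,\infty\}$, $m(s,s')=1$ iff $s=s'$. It is irreducible if it cannot be written as a non-trivial direct product (equivalently, its Coxeter diagram, the graph on $S$ with an edge between $s,s'$ iff $m(s,s')\ne 2$, is connected). A group is finitely torsion-generated if it is generated by finitely many elements of finite order. Elementary equivalence means satisfying the same first-order sentences in the language of groups. *)

(* Defs.v *)
From Stdlib Require Import List Relations.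

Record group := Group {
  carrier :> Type;
  gmul : carrier -> carrier -> carrier;
  ginv : carrier -> carrier;
  gone : carrier;
  gmulA : forall x y z, gmul x (gmul y z) = gmul (gmul x y) z;
  gmul1l : forall x, gmul gone x = x;
  gmulVl : forall x, gmul (ginv x) x = gone
}.
Arguments gmul {g}. Arguments ginv {g}. Arguments gone {g}.

Fixpoint gpow (G : group) (x : G) (n : nat) : G :=
  match n with O => gone | S k => gmul x (gpow G x k) end.

Definition generates (G : group) (P : G -> Prop) : Prop :=
  forall Q : G -> Prop,
    (forall x, P x -> Q x) -> Q gone ->
    (forall x y, Q x -> Q y -> Q (gmul x y)) ->
    (forall x, Q x -> Q (ginv x)) ->
    forall x, Q x.

Definition finitely_generated (G : group) : Prop :=
  exists l : list G, generates G (fun x => In x l).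

Definition finite_order (G : group) (x : G) : Prop :=
  exists n, 0 < n /\ gpow G x n = gone.

Definition finitely_torsion_generated (G : group) : Prop :=
  exists l : list G, (forall x, In x l -> finite_order G x) /\
                     generates G (fun x => In x l).

Definition is_hom (G H : group) (f : G -> H) : Prop :=
  forall x y, f (gmul x y) = gmul (f x) (f y).

(** * Coxeter groups
   A Coxeter matrix on an index type S: m : S -> S -> nat where the value 0
   encodes m = infinity; m symmetric, m s s' = 1 iff s = s'. *)
Definition coxeter_matrix (S : Type) (m : S -> S -> nat) : Prop :=
  (forall a b, m a b = m b a) /\ (forall a b, m a b = 1 <-> a = b).

Definition coxeter_relations (S : Type) (m : S -> S -> nat)
  (H : group) (f : S -> H) : Prop :=
  forall a b, m a b <> 0 -> gpow H (gmul (f a) (f b)) (m a b) = gone.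

Definition coxeter_presentation (G : group) (S : Type) (s : S -> G)
  (m : S -> S -> nat) : Prop :=
  coxeter_matrix S m /\
  (forall a b, s a = s b -> a = b) /\
  generates G (fun x => exists a, s a = x) /\
  coxeter_relations S m G s /\
  (forall (H : group) (f : S -> H), coxeter_relations S m H f ->
     exists phi : G -> H, is_hom G H phi /\ forall a, phi (s a) = f a).

Definition is_coxeter_group (G : group) : Prop :=
  exists (S : Type) (s : S -> G) (m : S -> S -> nat),
    coxeter_presentation G S s m.

Definition diagram_connected (S : Type) (m : S -> S -> nat) : Prop :=
  forall a b : S, clos_refl_trans S (fun x y => m x y <> 2) a b.

Definition is_irreducible_coxeter_group (G : group) : Prop :=
  exists (S : Type) (s : S -> G) (m : S -> S -> nat),
    coxeter_presentation G S s m /\ diagram_connected S m.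

Inductive term := Var (n : nat) | One | Mul (t u : term) | Inv (t : term).

Inductive formula :=
| FFalse | FEq (t u : term) | FNot (p : formula) | FAnd (p q : formula)
| FOr (p q : formula) | FImp (p q : formula)
| FForall (n : nat) (p : formula) | FExists (n : nat) (p : formula).

Fixpoint teval (G : group) (e : nat -> G) (t : term) : G :=
  match t with
  | Var n => e n
  | One => gone
  | Mul t u => gmul (teval G e t) (teval G e u)
  | Inv t => ginv (teval G e t)
  end.

Definition upd (G : group) (e : nat -> G) (n : nat) (x : G) : nat -> G :=
  fun k => if Nat.eqb k n then x else e k.

Fixpoint sat (G : group) (e : nat -> G) (p : formula) : Prop :=
  match p with
  | FFalse => False
  | FEq t u => teval G e t = teval G e u
  | FNot p => ~ sat G e p
  | FAnd p q => sat G e p /\ sat G e q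
  | FOr p q => sat G e p \/ sat G e q
  | FImp p q => sat G e p -> sat G e q
  | FForall n p => forall x : G, sat G (upd G e n x) p
  | FExists n p => exists x : G, sat G (upd G e n x) p
  end.

Fixpoint tocc (k : nat) (t : term) : Prop :=
  match t with
  | Var n => n = k
  | One => False
  | Mul t u => tocc k t \/ tocc k u
  | Inv t => tocc k t
  end.

Fixpoint free_in (k : nat) (p : formula) : Prop :=
  match p with
  | FFalse => False
  | FEq t u => tocc k t \/ tocc k u
  | FNot p => free_in k p
  | FAnd p q | FOr p q | FImp p q => free_in k p \/ free_in k q
  | FForall n p | FExists n p => n <> k /\ free_in k p
  end.

Definition sentence (p : formula) : Prop := forall k, ~ free_in k p.

(** G satisfies the sentence p (truth is independent of the assignment) *)
Definition models (G : group) (p : formula) : Prop := forall e, sat G e p.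

Definition elem_equiv (G H : group) : Prop :=
  forall p, sentence p -> (models G p <-> models H p).

(* Main.v *)
From Stdlib Require Import List Relations Arith Lia Bool FinFun.
From Stdlib Require Import Classical ClassicalEpsilon FunctionalExtensionality
  PropExtensionality ProofIrrelevance.
Require Import Defs.
Import ListNotations.

(** Every finitely generated Coxeter group [W] is the direct product of a finite Coxeter group
    [F] and of a Coxeter group [N] without nontrivial finite normal subgroups, and [N] has only
    finitely many direct factors. Both facts come from the inversion cocycle of [W]: the walls
    cut by a finite normal subgroup form a finite union of conjugacy classes of reflections, and
    a decomposition [N = A x B] is determined by recording, for each generator [r], whether its
    component in [A] negates the root of [r].

    The parameters of a direct decomposition are definable, since a factor of a centerless group
    is the centralizer of a finite tuple, and so is the equality of two decompositions. Hence if
    [G] is elementarily equivalent to [N = A x B], then [G] also has finitely many factors of this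
    shape, and by pigeonhole one decomposition [G = A' x B'] works for all sentences at once:
    [A'] is equivalent to [A] and [B'] to [B]. Splitting the diagram repeatedly reduces [N] to the
    irreducible case. The factor [F] is recovered separately: it is the only normal subgroup of
    [W] with its multiplication table and such that [W = F * C(F)], and a complement of it in [G]
    is built inside its centralizer [C] from the fact that no nontrivial element of [F] is a
    product of squares of elements of [C]. *)

(* The obstacle is the center. Every centralizer contains it, so a complement of a finite factor
   with nontrivial center is never a centralizer and cannot be handled like the factors of [N]. In
   [G] such a complement is constructed by choice instead of being defined. Its theory does not
   depend on the choice, because it is isomorphic to the quotient of [G] by the copy of [F], and
   that quotient is interpretable in [G].

   Squares enter because central elements of a Coxeter group are involutions: the centralizer of [F]
   is [Z(F) * N], so all its squares lie in [N]. Modulo squares the centralizer becomes a vector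
   space over the field with two elements, where complements exist.

   Finiteness of the set of factors of [N] is needed because elementary equivalence alone gives, for
   each sentence, some decomposition of [G] that depends on the sentence.

   No root system is built. The presentation only gives homomorphisms out of [W], and one
   homomorphism into a semidirect product yields inversion sets, hence the exchange property. That
   [x] negates the root of a reflection [r] with which it commutes means [inv x r = true]. *)
Declare Scope grp_scope.
Delimit Scope grp_scope with grp.
Notation "x * y" := (gmul x y) : grp_scope.
Notation "x ^-1" := (ginv x) (at level 3, left associativity, format "x ^-1") : grp_scope.
Local Open Scope grp_scope.

(** * Groups *)

Lemma gmulVr (G : group) (x : G) : x * x^-1 = gone.
Proof.
  rewrite <- (gmul1l G (x * x^-1)), <- (gmulVl G (x^-1)) at 1.
  rewrite <- gmulA, (gmulA G (x^-1) x), gmulVl, gmul1l. apply gmulVl.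
Qed.

Lemma gmul1r (G : group) (x : G) : x * gone = x.
Proof. rewrite <- (gmulVl G x), gmulA, gmulVr. apply gmul1l. Qed.

Lemma gmulVK (G : group) (x y : G) : x^-1 * (x * y) = y.
Proof. rewrite gmulA, gmulVl. apply gmul1l. Qed.

Lemma gmulKV (G : group) (x y : G) : x * (x^-1 * y) = y.
Proof. rewrite gmulA, gmulVr. apply gmul1l. Qed.

Lemma gmul_cancel_l (G : group) (x y z : G) : x * y = x * z -> y = z.
Proof. intros H. rewrite <- (gmulVK G x y), H. apply gmulVK. Qed.

Lemma gmul_cancel_r (G : group) (x y z : G) : y * x = z * x -> y = z.
Proof.
  intros H. rewrite <- (gmul1r G y), <- (gmul1r G z), <- (gmulVr G x), !gmulA, H.
  reflexivity.
Qed.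

Lemma ginv_unique (G : group) (x y : G) : x * y = gone -> y = x^-1.
Proof. intros H. apply (gmul_cancel_l G x). rewrite H. symmetry. apply gmulVr. Qed.

Lemma ginvV (G : group) (x : G) : (x^-1)^-1 = x.
Proof. symmetry. apply ginv_unique, gmulVl. Qed.

Lemma ginv1 (G : group) : (@gone G)^-1 = gone.
Proof. symmetry. apply ginv_unique, gmul1l. Qed.

Lemma gmulA' (G : group) (x y z : G) : (x * y) * z = x * (y * z).
Proof. symmetry. apply gmulA. Qed.

Lemma ginvM (G : group) (x y : G) : (x * y)^-1 = y^-1 * x^-1.
Proof.
  symmetry. apply ginv_unique.
  rewrite gmulA', (gmulA G y), gmulVr, gmul1l. apply gmulVr.
Qed.

Create HintDb grp discriminated.
#[global] Hint Rewrite gmulA' gmul1l gmul1r gmulVl gmulVr gmulVK gmulKV ginvV ginv1 ginvM : grp.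
Ltac grp := autorewrite with grp; try reflexivity.
Ltac grp_in H := autorewrite with grp in H.

Lemma gmul_eq1_iff (G : group) (x y : G) : x^-1 * y = gone <-> x = y.
Proof.
  split.
  - intros H. apply (gmul_cancel_l G (x^-1)). rewrite H. apply gmulVl.
  - intros ->. apply gmulVl.
Qed.

Lemma comm_inv (G : group) (x y : G) : x * y = y * x -> x^-1 * y = y * x^-1.
Proof.
  intros H. apply (gmul_cancel_l G x), (gmul_cancel_r G x). grp. symmetry. exact H.
Qed.

Lemma comm_mul (G : group) (x y z : G) :
  x * z = z * x -> y * z = z * y -> (x * y) * z = z * (x * y).
Proof. intros Hx Hy. rewrite gmulA', Hy, gmulA, Hx. apply gmulA'. Qed.

Lemma gpow_add (G : group) (x : G) (a b : nat) : gpow G x (a + b) = gpow G x a * gpow G x b.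
Proof. induction a as [|a IH]; simpl; [grp|rewrite IH; grp]. Qed.

Lemma gpow_comm_mul (G : group) (x y : G) (n : nat) :
  x * y = y * x -> gpow G (x * y) n = gpow G x n * gpow G y n.
Proof.
  intros H. induction n as [|n IH]; simpl; [grp|].
  rewrite IH. grp. f_equal. rewrite !gmulA. f_equal.
  clear IH. induction n as [|n IH]; simpl; [grp|].
  rewrite gmulA, <- H, gmulA', IH. grp.
Qed.

Lemma gpow_invol (G : group) (x : G) (k : nat) : x * x = gone -> gpow G x (k + k) = gone.
Proof.
  intros H. induction k as [|k IH]; [reflexivity|].
  replace (S k + S k) with (S (S (k + k))) by lia. simpl. rewrite IH. grp. exact H.
Qed.

Lemma invol_comm (G : group) (x y : G) :
  x * x = gone -> y * y = gone -> (x * y) * (x * y) = gone -> x * y = y * x.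
Proof.
  intros Hx Hy H. apply (gmul_cancel_r G (x * y)). rewrite H.
  rewrite <- Hy at 1. grp. f_equal. rewrite gmulA, Hx. grp.
Qed.

Lemma hom_one (G H : group) (f : G -> H) : is_hom G H f -> f gone = gone.
Proof.
  intros Hf. apply (gmul_cancel_l H (f gone)). rewrite <- Hf. grp.
Qed.

Lemma hom_inv (G H : group) (f : G -> H) (x : G) : is_hom G H f -> f (x^-1) = (f x)^-1.
Proof.
  intros Hf. apply ginv_unique. rewrite <- Hf. grp. apply hom_one, Hf.
Qed.

Lemma hom_pow (G H : group) (f : G -> H) (x : G) (n : nat) :
  is_hom G H f -> f (gpow G x n) = gpow H (f x) n.
Proof.
  intros Hf. induction n as [|n IH]; simpl; [apply hom_one, Hf|].
  rewrite Hf, IH. reflexivity.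
Qed.

(** * Subgroups and internal direct products *)

Definition subgroup (G : group) (P : G -> Prop) : Prop :=
  P gone /\ (forall x y, P x -> P y -> P (x * y)) /\ (forall x, P x -> P (x^-1)).

Lemma sub_one (G : group) (P : G -> Prop) : subgroup G P -> P gone.
Proof. intros H. apply H. Qed.
Lemma sub_mul (G : group) (P : G -> Prop) (x y : G) : subgroup G P -> P x -> P y -> P (x * y).
Proof. intros H. apply H. Qed.
Lemma sub_inv (G : group) (P : G -> Prop) (x : G) : subgroup G P -> P x -> P (x^-1).
Proof. intros H. apply H. Qed.

Definition normal (G : group) (P : G -> Prop) : Prop :=
  forall g x, P x -> P (g * x * g^-1).

Lemma sig_eq (T : Type) (P : T -> Prop) (x y : {t | P t}) : proj1_sig x = proj1_sig y -> x = y.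
Proof. apply eq_sig_hprop. intros. apply proof_irrelevance. Qed.

Definition sub (G : group) (P : G -> Prop) (H : subgroup G P) : group.
Proof.
  refine (Group {x : G | P x}
    (fun x y => exist _ (proj1_sig x * proj1_sig y)
                  (sub_mul G P _ _ H (proj2_sig x) (proj2_sig y)))
    (fun x => exist _ ((proj1_sig x)^-1) (sub_inv G P _ H (proj2_sig x)))
    (exist _ gone (sub_one G P H)) _ _ _);
    intros; apply sig_eq; simpl; grp.
Defined.

Lemma sub_val_hom (G : group) (P : G -> Prop) (H : subgroup G P) :
  is_hom (sub G P H) G (fun x => proj1_sig x).
Proof. intros x y. reflexivity. Qed.

Definition gen (G : group) (P : G -> Prop) : G -> Prop :=
  fun x => forall Q, subgroup G Q -> (forall y, P y -> Q y) -> Q x.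

Lemma gen_subgroup (G : group) (P : G -> Prop) : subgroup G (gen G P).
Proof.
  split; [|split].
  - intros Q HQ _. apply sub_one, HQ.
  - intros x y Hx Hy Q HQ HP. apply sub_mul; [|apply Hx|apply Hy]; auto.
  - intros x Hx Q HQ HP. apply sub_inv; [|apply Hx]; auto.
Qed.

Lemma gen_in (G : group) (P : G -> Prop) (x : G) : P x -> gen G P x.
Proof. intros Hx Q _ HP. auto. Qed.

Lemma generates_sub (G : group) (P Q : G -> Prop) :
  generates G P -> subgroup G Q -> (forall x, P x -> Q x) -> forall x, Q x.
Proof. intros H (H1 & H2 & H3) HP. apply H; auto. Qed.

Lemma centralizer_subgroup (G : group) (P : G -> Prop) :
  subgroup G (fun x => forall y, P y -> x * y = y * x).
Proof.
  split; [|split].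
  - intros y _. grp.
  - intros x y Hx Hy z Hz. apply comm_mul; auto.
  - intros x Hx y Hy. apply comm_inv. auto.
Qed.

Lemma gen_commute (G : group) (P Q : G -> Prop) :
  (forall x y, P x -> Q y -> x * y = y * x) ->
  forall x y, gen G P x -> gen G Q y -> x * y = y * x.
Proof.
  intros H x y Hx Hy. revert y Hy. apply (Hx (fun x => forall y, gen G Q y -> x * y = y * x)).
  - apply centralizer_subgroup.
  - intros z Hz y Hy. symmetry. apply (Hy (fun y => forall z, P z -> y * z = z * y)); auto.
    + apply centralizer_subgroup.
    + intros. symmetry. auto.
Qed.

Definition fac (G : group) (M N : G -> Prop) : Prop :=
  subgroup G M /\ subgroup G N /\
  (forall x y, M x -> N y -> x * y = y * x) /\
  (forall x, M x -> N x -> x = gone) /\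
  (forall g, exists x y, M x /\ N y /\ g = x * y).

Lemma fac_sym (G : group) (M N : G -> Prop) : fac G M N -> fac G N M.
Proof.
  intros (HM & HN & Hc & Hi & Hs). repeat split; try apply HM; try apply HN.
  - intros x y Hx Hy. symmetry. auto.
  - intros x Hx Hy. auto.
  - intros g. destruct (Hs g) as (x & y & Hx & Hy & ->). exists y, x. auto.
Qed.

Lemma fac_uniq (G : group) (M N : G -> Prop) (x x' y y' : G) :
  fac G M N -> M x -> M x' -> N y -> N y' -> x * y = x' * y' -> x = x' /\ y = y'.
Proof.
  intros (HM & HN & Hc & Hi & Hs) Hx Hx' Hy Hy' E.
  assert (E' : x'^-1 * x = y' * y^-1).
  { apply (gmul_cancel_r G y), (gmul_cancel_l G x'). grp. exact E. }
  assert (E1 : x'^-1 * x = gone).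
  { apply Hi; [|rewrite E']; (apply sub_mul; [assumption| |]); auto; apply sub_inv; auto. }
  split; [symmetry; apply gmul_eq1_iff, E1|].
  rewrite E' in E1. apply (gmul_cancel_r G (y^-1)). rewrite E1. grp.
Qed.

Lemma fac_proj (G : group) (M N : G -> Prop) : fac G M N ->
  exists p q : G -> G,
    is_hom G G p /\ is_hom G G q /\
    (forall g, M (p g)) /\ (forall g, N (q g)) /\ (forall g, g = p g * q g) /\
    (forall x y, M x -> N y -> p (x * y) = x /\ q (x * y) = y).
Proof.
  intros F. pose proof F as (HM & HN & Hc & Hi & Hs).
  destruct (choice (fun g (xy : G * G) => M (fst xy) /\ N (snd xy) /\ g = fst xy * snd xy))
    as [pq Hpq].
  { intros g. destruct (Hs g) as (x & y & H). exists (x, y). exact H. }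
  assert (U : forall x y, M x -> N y -> fst (pq (x * y)) = x /\ snd (pq (x * y)) = y).
  { intros x y Hx Hy. destruct (Hpq (x * y)) as (H1 & H2 & H3).
    destruct (fac_uniq G M N _ _ _ _ F Hx H1 Hy H2 H3). auto. }
  assert (E : forall g h, g * h = fst (pq g) * fst (pq h) * (snd (pq g) * snd (pq h))).
  { intros g h. destruct (Hpq g) as (H1 & H2 & H3). destruct (Hpq h) as (H4 & H5 & H6).
    rewrite H3, H6 at 1. rewrite !gmulA'. f_equal. rewrite !gmulA. f_equal.
    symmetry. apply Hc; auto. }
  assert (E' : forall g h, fst (pq (g * h)) = fst (pq g) * fst (pq h)
                       /\ snd (pq (g * h)) = snd (pq g) * snd (pq h)).
  { intros g h. destruct (Hpq g) as (H1 & H2 & H3). destruct (Hpq h) as (H4 & H5 & H6).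
    rewrite E. apply U; apply sub_mul; auto. }
  exists (fun g => fst (pq g)), (fun g => snd (pq g)). repeat split.
  - intros g h. apply E'.
  - intros g h. apply E'.
  - intros g. apply Hpq.
  - intros g. apply Hpq.
  - intros g. apply Hpq.
  - apply U; auto.
  - apply U; auto.
Qed.

Lemma fac_normal (G : group) (M N : G -> Prop) : fac G M N -> normal G M.
Proof.
  intros (HM & HN & Hc & Hi & Hs) g x Hx. destruct (Hs g) as (a & b & Ha & Hb & ->).
  replace (a * b * x * (a * b)^-1) with (a * x * a^-1).
  { repeat apply sub_mul; auto. apply sub_inv; auto. }
  grp. f_equal. rewrite (gmulA G b), <- (Hc x b) by auto. grp.
Qed.

(** * Finite sets *)

Definition finite {T : Type} (P : T -> Prop) : Prop := exists l, forall x, P x -> In x l.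

Lemma finite_inj {A B : Type} (P : A -> Prop) (f : A -> B) (l : list B) :
  (forall x, P x -> In (f x) l) ->
  (forall x y, P x -> P y -> f x = f y -> x = y) -> finite P.
Proof.
  revert P. induction l as [|b l IH]; intros P Hl Hf.
  - exists []. exact Hl.
  - destruct (IH (fun x => P x /\ f x <> b)) as [la Hla].
    + intros x [Hx Hb]. destruct (Hl x Hx); [congruence|assumption].
    + intros x y [Hx _] [Hy _]. auto.
    + destruct (classic (exists a, P a /\ f a = b)) as [(a & Ha & Hab)|Hn].
      * exists (a :: la). intros x Hx. destruct (classic (f x = b)) as [E|E].
        -- left. apply Hf; auto. congruence.
        -- right. auto.
      * exists la. intros x Hx. apply Hla. split; auto. intros E. apply Hn. eauto.
Qed.

Fixpoint words {B : Type} (l : list B) (n : nat) : list (list B) :=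
  match n with
  | O => [[]]
  | S n => flat_map (fun b => map (cons b) (words l n)) l
  end.

Lemma words_in {A B : Type} (l : list B) (f : A -> B) (la : list A) :
  (forall a, In a la -> In (f a) l) -> In (map f la) (words l (length la)).
Proof.
  induction la as [|a la IH]; intros H; simpl; [auto|].
  apply in_flat_map. exists (f a). split; [apply H; simpl; auto|].
  apply in_map, IH. intros b Hb. apply H. simpl. auto.
Qed.

Lemma map_eq_on {A B : Type} (f g : A -> B) (l : list A) (a : A) :
  map f l = map g l -> In a l -> f a = g a.
Proof.
  induction l as [|b l IH]; simpl; [tauto|].
  intros [= E1 E2] [->|H]; auto.
Qed.

(** Finiteness in the form that transfers between groups: for a fixed [q], the coincidence of two
    among any [q + 1] members becomes a sentence once members are coded by tuples.
    [pigeonhole_finite] is the way back. *)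
Lemma finite_pigeonhole {T : Type} (P : T -> Prop) : finite P ->
  exists q, forall f : nat -> T, (forall i, i <= q -> P (f i)) ->
    exists i j, i < j /\ j <= q /\ f i = f j.
Proof.
  intros [l Hl]. exists (length l). intros f Hf. apply NNPP. intros Hn.
  assert (ND : NoDup (map f (seq 0 (S (length l))))).
  { apply NoDup_map_NoDup_ForallPairs; [|apply seq_NoDup].
    intros i j Hi Hj E. apply in_seq in Hi, Hj. simpl in Hi, Hj.
    destruct (Nat.lt_trichotomy i j) as [H|[H|H]]; auto; exfalso; apply Hn.
    - exists i, j. repeat split; auto; lia.
    - exists j, i. repeat split; auto; lia. }
  assert (L : length (map f (seq 0 (S (length l)))) <= length l).
  { apply NoDup_incl_length; auto. intros x Hx. apply in_map_iff in Hx.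
    destruct Hx as (i & <- & Hi). apply in_seq in Hi. apply Hl, Hf. lia. }
  rewrite length_map, length_seq in L. lia.
Qed.

Lemma pigeonhole_finite {T : Type} (P : T -> Prop) (q : nat) :
  (forall f : nat -> T, (forall i, i <= q -> P (f i)) ->
    exists i j, i < j /\ j <= q /\ f i = f j) -> finite P.
Proof.
  intros H. apply NNPP. intros Hn.
  assert (B : forall k, exists l, length l = k /\ NoDup l /\ forall x, In x l -> P x).
  { induction k as [|k (l & L & ND & Hl)].
    - exists []. repeat split; [constructor|simpl; tauto].
    - destruct (classic (exists x, P x /\ ~ In x l)) as [(x & Hx & Hx')|Hc].
      + exists (x :: l). repeat split; [simpl; congruence|constructor; auto|].
        intros y [<-|Hy]; auto.
      + exfalso. apply Hn. exists l. intros x Hx. apply NNPP. intros Hx'. apply Hc. eauto. }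
  destruct (B (S q)) as ([|d l] & L & ND & Hl); [discriminate|].
  destruct (H (fun i => nth i (d :: l) d)) as (i & j & Hij & Hj & E).
  - intros i Hi. apply Hl, nth_In. lia.
  - apply NoDup_nth in E; auto; lia.
Qed.

(** The codes become variable names for the elements of the finite factor; the bound leaves the
    variables from [length l] on free for quantifiers and further parameters. *)
Lemma finite_code {T : Type} (l : list T) : exists c : T -> nat,
  (forall x y, In x l -> In y l -> c x = c y -> x = y) /\
  (forall x, In x l -> c x < length l).
Proof.
  induction l as [|a l (c & Hc & Hb)].
  - exists (fun _ => 0). simpl. tauto.
  - exists (fun x => if excluded_middle_informative (x = a) then length l else c x).
    split; simpl.
    + intros x y Hx Hy. destruct excluded_middle_informative as [->|Nx];
        destruct excluded_middle_informative as [->|Ny]; auto.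
      * destruct Hy as [->|Hy]; [auto|]. specialize (Hb y Hy). lia.
      * destruct Hx as [->|Hx]; [auto|]. specialize (Hb x Hx). lia.
      * destruct Hx as [->|Hx]; [tauto|]. destruct Hy as [->|Hy]; [tauto|]. auto.
    + intros x Hx. destruct excluded_middle_informative as [->|Nx]; [lia|].
      destruct Hx as [->|Hx]; [tauto|]. specialize (Hb x Hx). lia.
Qed.

(** The strict inequality drives the induction on the rank: each side of a proper splitting of the
    diagram has fewer generators. *)
Lemma sig_list {T : Type} (P : T -> Prop) (l : list T) :
  exists l' : list {x | P x},
    (forall a, In (proj1_sig a) l -> In a l') /\
    length l' <= length l /\
    ((exists b, In b l /\ ~ P b) -> length l' < length l).
Proof.
  induction l as [|a l (l' & H1 & H2 & H3)].
  - exists []. simpl. repeat split; auto. intros (b & [] & _).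
  - destruct (classic (P a)) as [Ha|Ha].
    + exists (exist _ a Ha :: l'). simpl. repeat split; [|lia|].
      * intros x [E|Hx]; [left; apply sig_eq; exact E|right; auto].
      * intros (b & [->|Hb] & Hnb); [tauto|]. assert (length l' < length l) by eauto. lia.
    + exists l'. simpl. repeat split; [|lia|lia].
      intros x [E|Hx]; auto. exfalso. apply Ha. rewrite E. apply proj2_sig.
Qed.

(** * Inversion sets *)

Definition dec (P : Prop) : bool := if excluded_middle_informative P then true else false.

Lemma dec_true (P : Prop) : P -> dec P = true.
Proof. unfold dec. destruct excluded_middle_informative; tauto. Qed.
Lemma dec_false (P : Prop) : ~ P -> dec P = false.
Proof. unfold dec. destruct excluded_middle_informative; tauto. Qed.
Lemma dec_elim (P : Prop) : dec P = true -> P.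
Proof. unfold dec. destruct excluded_middle_informative; [auto|discriminate]. Qed.
Lemma dec_iff (P Q : Prop) : (P <-> Q) -> dec P = dec Q.
Proof. unfold dec. do 2 destruct excluded_middle_informative; tauto. Qed.

Fixpoint xsum (f : nat -> bool) (n : nat) : bool :=
  match n with O => false | S n => xorb (f 0) (xsum (fun j => f (S j)) n) end.

Lemma xsum_ext (f g : nat -> bool) (n : nat) : (forall j, f j = g j) -> xsum f n = xsum g n.
Proof. intros H. f_equal. apply functional_extensionality, H. Qed.

Lemma xsum_add (f : nat -> bool) (n k : nat) :
  xsum f (n + k) = xorb (xsum f n) (xsum (fun j => f (n + j)) k).
Proof.
  revert f. induction n as [|n IH]; intros f; simpl.
  - destruct (xsum _ k); reflexivity.
  - rewrite IH, xorb_assoc. reflexivity.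
Qed.

(* The semidirect product of [W] with the functions [W -> F_2], on which [W] acts by
   conjugation of the argument; an inversion cocycle is a section of it. *)
Definition twist (W : group) : group.
Proof.
  refine (Group (W * (W -> bool))%type
    (fun x y => (fst x * fst y, fun g => xorb (snd x g) (snd y ((fst x)^-1 * g * fst x))))
    (fun x => ((fst x)^-1, fun g => snd x (fst x * g * (fst x)^-1)))
    (gone, fun _ => false) _ _ _).
  - intros [x p] [y q] [z r]. simpl. f_equal; [apply gmulA|].
    apply functional_extensionality. intros g. rewrite xorb_assoc. do 3 f_equal. grp.
  - intros [x p]. simpl. f_equal; [apply gmul1l|].
    apply functional_extensionality. intros g. grp.
  - intros [x p]. simpl. f_equal; [apply gmulVl|].
    apply functional_extensionality. intros g. grp. apply xorb_nilpotent.
Defined.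

Definition no_finite_normal (G : group) : Prop :=
  forall K : G -> Prop, subgroup G K -> normal G K -> finite K -> forall x, K x -> x = gone.

Definition centerless (G : group) : Prop :=
  forall z : G, (forall w, z * w = w * z) -> z = gone.

(* In a centerless group a direct factor is the centralizer of its complement. *)
Lemma fac_refine (G : group) (A B C D : G -> Prop) (p q : G -> G) (x : G) :
  centerless G -> fac G A B -> fac G C D -> is_hom G G p ->
  (forall g, C (p g)) -> (forall g, D (q g)) -> (forall g, g = p g * q g) ->
  A x -> A (p x).
Proof.
  intros HZ (HA & HB & Hc & Hi & Hs) (_ & _ & Hc' & _ & _) Hp HC HD Hpq Hx.
  assert (Cm : forall b, B b -> p x * b = b * p x).
  { intros b Hb. rewrite (Hpq b), gmulA', <- (Hc' (p x) (q b)) by auto.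
    rewrite !gmulA. f_equal. rewrite <- !Hp. f_equal. auto. }
  destruct (Hs (p x)) as (a & b & Ha & Hb & E).
  assert (Eb : b = gone).
  { apply HZ. intros w. destruct (Hs w) as (c & d & Hc1 & Hd & ->).
    assert (b * d = d * b).
    { replace b with (a^-1 * p x) by (rewrite E; grp).
      apply comm_mul; [apply comm_inv|]; auto. }
    symmetry. apply comm_mul; [auto|]. symmetry. auto. }
  rewrite E, Eb, gmul1r. exact Ha.
Qed.

Lemma filter_length_lt {T : Type} (f g : T -> bool) (l : list T) (a : T) :
  (forall x, g x = true -> f x = true) -> In a l -> f a = true -> g a = false ->
  length (filter g l) < length (filter f l).
Proof.
  intros H Ha Hf Hg.
  assert (L : forall l, length (filter g l) <= length (filter f l)).
  { induction l0 as [|x l0 IH]; simpl; [lia|]. specialize (H x).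
    destruct (g x), (f x); simpl; lia. }
  induction l as [|x l IH]; simpl in *; [tauto|].
  destruct Ha as [->|Ha].
  - rewrite Hf, Hg. simpl. specialize (L l). lia.
  - specialize (IH Ha). specialize (H x). destruct (g x), (f x); simpl; lia.
Qed.

Section Coxeter.
Variables (W : group) (S : Type) (s : S -> W) (m : S -> S -> nat).
Hypothesis pres : coxeter_presentation W S s m.

Lemma rel_invol (H : group) (f : S -> H) (I : S -> Prop) :
  (forall a b, I a -> I b -> m a b <> 0 -> gpow H (f a * f b) (m a b) = gone) ->
  forall a, I a -> f a * f a = gone.
Proof.
  intros Hf a Ha. destruct pres as ((_ & H1) & _).
  assert (E : m a a = 1) by (apply H1; reflexivity).
  specialize (Hf a a Ha Ha). rewrite E in Hf. simpl in Hf. rewrite gmul1r in Hf. auto.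
Qed.

Lemma s_invol (a : S) : s a * s a = gone.
Proof.
  apply (rel_invol W s (fun _ => True)); auto.
  intros x y _ _. destruct pres as (_ & _ & _ & H & _). apply H.
Qed.

Lemma s_involK (a : S) (x : W) : s a * (s a * x) = x.
Proof. rewrite gmulA, s_invol. apply gmul1l. Qed.

Lemma s_inv (a : S) : (s a)^-1 = s a.
Proof. symmetry. apply ginv_unique, s_invol. Qed.

Hint Rewrite s_invol s_involK s_inv : grp.

Lemma s_inj (a b : S) : s a = s b -> a = b.
Proof. destruct pres as (_ & H & _). apply H. Qed.

(** The alternating word of length [n + n] in [a] and [b] crosses the walls of the reflections
    [(ab)^j a] in order; the second component counts the crossings of each wall modulo 2. *)
Lemma twist_pow (a b : S) (n : nat) :
  gpow (twist W) (@gmul (twist W) (s a, fun g => dec (g = s a)) (s b, fun g => dec (g = s b))) n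
  = (gpow W (s a * s b) n,
     fun g => xsum (fun j => dec (g = gpow W (s a * s b) j * s a)) (n + n)).
Proof.
  induction n as [|n IH]; [reflexivity|].
  replace (Datatypes.S n + Datatypes.S n) with (Datatypes.S (Datatypes.S (n + n))) by lia.
  cbn [gpow]. rewrite IH. unfold gmul at 1. cbn [twist fst snd]. f_equal.
  apply functional_extensionality. intros g.
  set (c := s a * s b).
  change (xorb (xorb (dec (g = s a)) (dec ((s a)^-1 * g * s a = s b)))
            (xsum (fun j => dec (c^-1 * g * c = gpow W c j * s a)) (n + n))
          = xorb (dec (g = gone * s a)) (xorb (dec (g = c * gone * s a))
              (xsum (fun j => dec (g = c * (c * gpow W c j) * s a)) (n + n)))).
  rewrite xorb_assoc.
  (* Conjugation by [s a] inverts [c = s a * s b], so conjugating [c^j * s a] by [c] raises the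
     exponent [j] by two. *)
  assert (Hc : s a * c^-1 = c * s a) by (unfold c; grp).
  f_equal; [|f_equal].
  - unfold c. apply dec_iff. grp.
  - apply dec_iff. split; intros H.
    + replace g with (s a * (s a * g * s a) * s a) by grp.
      rewrite s_inv in H. rewrite H. unfold c. grp.
    + rewrite H. unfold c. grp.
  - apply xsum_ext. intros j. apply dec_iff. set (d := gpow W c j).
    assert (Hd : d * c = c * d).
    { unfold d. rewrite <- (gmul1r W c) at 2 3. change (c * gone) with (gpow W c 1).
      rewrite <- !gpow_add, Nat.add_comm. reflexivity. }
    assert (E : c * (c * d) * s a = c * (d * s a) * c^-1).
    { rewrite !gmulA', Hc, (gmulA W d), Hd. grp. }
    rewrite E. split; intros H.
    + rewrite <- H. grp.
    + rewrite H. grp.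
Qed.

(** If [(ab)^m = 1], the reflections with indices [j] and [m + j] in [twist_pow] agree, so every
    wall is crossed an even number of times and the Coxeter relations hold in [twist W]. *)
Lemma inversion_cocycle : exists N : W -> W -> bool,
  (forall x y g, N (x * y) g = xorb (N x g) (N y (x^-1 * g * x))) /\
  (forall a g, N (s a) g = dec (g = s a)).
Proof.
  destruct pres as (_ & _ & Hg & Hr & Hu).
  destruct (Hu (twist W) (fun a => (s a, fun g => dec (g = s a)))) as (phi & Hphi & Hs).
  - intros a b Hab. rewrite twist_pow, (Hr a b Hab).
    change (@gone (twist W)) with (@gone W, fun _ : W => false). f_equal.
    apply functional_extensionality. intros g.
    rewrite xsum_add.
    rewrite (xsum_ext (fun j => dec (g = gpow W (s a * s b) (m a b + j) * s a))
                      (fun j => dec (g = gpow W (s a * s b) j * s a))).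
    + apply xorb_nilpotent.
    + intros j. rewrite gpow_add, (Hr a b Hab), gmul1l. reflexivity.
  (* The first component of [phi] is an endomorphism that fixes the generators, so [phi] is a
     section of the semidirect product. *)
  - assert (E : forall w, fst (phi w) = w).
    { apply (generates_sub W _ (fun w => fst (phi w) = w) Hg).
      - split; [|split].
        + rewrite (hom_one _ _ _ Hphi). reflexivity.
        + intros x y Hx Hy. rewrite Hphi. change (fst (phi x) * fst (phi y) = x * y). congruence.
        + intros x Hx. rewrite (hom_inv _ _ _ _ Hphi). change ((fst (phi x))^-1 = x^-1). congruence.
      - intros x (a & <-). rewrite Hs. reflexivity. }
    exists (fun w => snd (phi w)). split.
    + intros x y g. rewrite Hphi.
      change (xorb (snd (phi x) g) (snd (phi y) ((fst (phi x))^-1 * g * fst (phi x)))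
              = xorb (snd (phi x) g) (snd (phi y) (x^-1 * g * x))).
      rewrite E. reflexivity.
    + intros a g. rewrite Hs. reflexivity.
Qed.

(* [inv w g] tells whether [g] is a reflection whose wall separates [w] from the identity. *)
Definition inv : W -> W -> bool :=
  proj1_sig (constructive_indefinite_description _ inversion_cocycle).

Lemma inv_mul (x y g : W) : inv (x * y) g = xorb (inv x g) (inv y (x^-1 * g * x)).
Proof. unfold inv. destruct constructive_indefinite_description as (N & H). apply H. Qed.

Lemma inv_gen (a : S) (g : W) : inv (s a) g = dec (g = s a).
Proof. unfold inv. destruct constructive_indefinite_description as (N & H). apply H. Qed.

Lemma inv_gen_self (a : S) : inv (s a) (s a) = true.
Proof. rewrite inv_gen. apply dec_true. reflexivity. Qed.

Lemma inv_one (g : W) : inv gone g = false.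
Proof.
  pose proof (inv_mul gone gone g) as H. rewrite ginv1, !gmul1l, gmul1r in H.
  rewrite xorb_nilpotent in H. exact H.
Qed.

Lemma inv_inv (x g : W) : inv (x^-1) g = inv x (x * g * x^-1).
Proof.
  pose proof (inv_mul (x^-1) x g) as H. rewrite gmulVl, inv_one, ginvV in H.
  apply xorb_eq. symmetry. exact H.
Qed.

(** * Words, their reflections and the exchange property *)

Fixpoint ev (l : list S) : W :=
  match l with [] => gone | a :: l => s a * ev l end.

(** The reflections in the walls that the gallery of the word crosses, in order: the prefix before
    each letter conjugates that letter. *)
Fixpoint refl (l : list S) : list W :=
  match l with [] => [] | a :: l => s a :: map (fun t => s a * t * s a) (refl l) end.

Lemma refl_length (l : list S) : length (refl l) = length l.
Proof. induction l; simpl; rewrite ?length_map; congruence. Qed.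

Lemma ev_app (l l' : list S) : ev (l ++ l') = ev l * ev l'.
Proof. induction l as [|a l IH]; simpl; [grp|rewrite IH; grp]. Qed.

Lemma ev_rev (l : list S) : ev (rev l) = (ev l)^-1.
Proof. induction l as [|a l IH]; simpl; [grp|rewrite ev_app, IH; simpl; grp]. Qed.

Lemma inv_ev_in (l : list S) (g : W) : inv (ev l) g = true -> In g (refl l).
Proof.
  revert g. induction l as [|a l IH]; intros g; simpl.
  - rewrite inv_one. discriminate.
  - rewrite inv_mul, inv_gen. intros H.
    destruct (classic (g = s a)) as [E|E]; [auto|right].
    rewrite (dec_false _ E) in H. apply in_map_iff.
    exists ((s a)^-1 * g * s a). split; [grp|apply IH, H].
Qed.

(** Left multiplication by the reflection that belongs to a letter deletes that letter. The
    inclusion keeps the shorter word inside a standard parabolic subgroup. *)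
Lemma exchange (l : list S) (r : W) : In r (refl l) ->
  exists l', Datatypes.S (length l') = length l /\ ev l' = r * ev l /\ incl l' l.
Proof.
  revert r. induction l as [|a l IH]; intros r; simpl; [tauto|].
  intros [<-|H].
  - exists l. repeat split; [grp|]. intros x Hx. simpl. auto.
  - apply in_map_iff in H. destruct H as (t & <- & Ht).
    destruct (IH t Ht) as (l' & H1 & H2 & H3). exists (a :: l'). repeat split.
    + simpl. congruence.
    + simpl. rewrite H2. grp.
    + intros x [->|Hx]; simpl; auto.
Qed.

(** * Standard parabolic subgroups and reduced words *)

Definition par (I : S -> Prop) : W -> Prop := gen W (fun x => exists a, I a /\ s a = x).

Lemma par_gen (I : S -> Prop) (a : S) : I a -> par I (s a).
Proof. intros H. apply gen_in. eauto. Qed.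

Lemma par_ev (I : S -> Prop) (l : list S) : Forall I l -> par I (ev l).
Proof.
  induction 1 as [|a l Ha Hl IH]; simpl.
  - apply sub_one, gen_subgroup.
  - apply sub_mul; [apply gen_subgroup|apply par_gen, Ha|exact IH].
Qed.

Lemma par_word (I : S -> Prop) (w : W) : par I w -> exists l, Forall I l /\ ev l = w.
Proof.
  intros H. apply H.
  - split; [|split].
    + exists []. auto.
    + intros x y (l & Hl & <-) (l' & Hl' & <-). exists (l ++ l').
      rewrite ev_app. split; [apply Forall_app; auto|reflexivity].
    + intros x (l & Hl & <-). exists (rev l). rewrite ev_rev.
      split; [apply Forall_rev, Hl|reflexivity].
  - intros y (a & Ha & <-). exists [a]. simpl. split; [auto|grp].
Qed.

Lemma par_mono (I J : S -> Prop) (w : W) : (forall a, I a -> J a) -> par I w -> par J w.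
Proof.
  intros H Hw. apply Hw; [apply gen_subgroup|]. intros y (a & Ha & <-). apply par_gen; auto.
Qed.

Lemma par_full (w : W) : par (fun _ => True) w.
Proof.
  destruct pres as (_ & _ & Hg & _). apply (generates_sub _ _ _ Hg); [apply gen_subgroup|].
  intros x (a & <-). apply par_gen. auto.
Qed.

(** Minimality is required among words over [I] only. By [reduced_NoDup] and [reduced_inv] the
    length is nevertheless the number of inversions of [w], in which [I] does not occur. *)
Definition reduced (I : S -> Prop) (w : W) (l : list S) : Prop :=
  Forall I l /\ ev l = w /\
  forall l', Forall I l' -> ev l' = w -> length l <= length l'.

Lemma reduced_exists (I : S -> Prop) (w : W) : par I w -> exists l, reduced I w l.
Proof.
  intros H. destruct (par_word I w H) as (l & Hl). remember (length l) as n eqn:E.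
  revert l Hl E. induction n as [n IH] using lt_wf_ind. intros l Hl E.
  destruct (classic (exists l', Forall I l' /\ ev l' = w /\ length l' < n)) as [(l' & H1 & H2 & H3)|C].
  - apply (IH _ H3 l'); auto.
  - exists l. split; [apply Hl|split; [apply Hl|]]. intros l' H1 H2.
    destruct (le_lt_dec (length l) (length l')); auto.
    exfalso. apply C. exists l'. rewrite E. auto.
Qed.

Lemma incl_Forall_sub (I : S -> Prop) (l l' : list S) : incl l' l -> Forall I l -> Forall I l'.
Proof. rewrite !Forall_forall. auto. Qed.

(** If the reflection of the first letter occurred again, [exchange] would absorb the first letter
    by deleting a later one, and two letters would be saved. *)
Lemma reduced_NoDup (I : S -> Prop) (w : W) (l : list S) : reduced I w l -> NoDup (refl l).
Proof.
  revert w. induction l as [|a l IH]; intros w (H1 & H2 & H3); simpl; [constructor|].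
  inversion H1 as [|? ? Ha Hl]; subst.
  constructor.
  - intros H. apply in_map_iff in H. destruct H as (t & E & Ht).
    assert (E' : t = s a).
    { replace t with (s a * (s a * t * s a) * s a) by grp. rewrite E. grp. }
    rewrite E' in Ht. destruct (exchange _ _ Ht) as (l' & L1 & L2 & L3).
    assert (length (a :: l) <= length l').
    { apply H3; [apply (incl_Forall_sub I l); auto|]. rewrite L2. reflexivity. }
    simpl in *. lia.
  - apply NoDup_map_NoDup_ForallPairs.
    + intros x y _ _ E. apply (gmul_cancel_r _ (s a)), (gmul_cancel_l _ (s a)).
      rewrite !gmulA. exact E.
    + apply (IH (ev l)). repeat split; auto. intros l' Hl' E.
      assert (length (a :: l) <= length (a :: l')).
      { apply H3; [constructor; auto|]. simpl. congruence. }
      simpl in *. lia.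
Qed.

Lemma inv_ev_iff (l : list S) (g : W) : NoDup (refl l) -> In g (refl l) -> inv (ev l) g = true.
Proof.
  revert g. induction l as [|a l IH]; intros g; simpl; [tauto|].
  intros ND Hg. inversion ND as [|? ? Hn ND']; subst.
  rewrite inv_mul, inv_gen.
  destruct (classic (g = s a)) as [->|E].
  - rewrite dec_true by reflexivity.
    assert (F : inv (ev l) ((s a)^-1 * s a * s a) = false).
    { apply not_true_is_false. intros H. apply Hn, in_map_iff.
      apply inv_ev_in in H. exists ((s a)^-1 * s a * s a). split; [grp|exact H]. }
    rewrite F. reflexivity.
  - rewrite (dec_false _ E). destruct Hg as [Hg|Hg]; [congruence|].
    apply in_map_iff in Hg. destruct Hg as (t & <- & Ht).
    replace ((s a)^-1 * (s a * t * s a) * s a) with t by grp.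
    rewrite IH; auto. apply NoDup_map_inv in ND'. exact ND'.
Qed.

Lemma reduced_inv (I : S -> Prop) (w : W) (l : list S) (g : W) :
  reduced I w l -> (In g (refl l) <-> inv w g = true).
Proof.
  intros H. pose proof (reduced_NoDup _ _ _ H) as ND. destruct H as (_ & <- & _).
  split; [apply inv_ev_iff, ND|apply inv_ev_in].
Qed.

Lemma inv_trivial (w : W) : (forall g, inv w g = false) -> w = gone.
Proof.
  intros H. destruct (reduced_exists _ w (par_full w)) as (l & Hl).
  destruct l as [|a l]; [symmetry; apply Hl|].
  assert (E : inv w (s a) = true) by (apply (reduced_inv _ _ _ _ Hl); simpl; auto).
  rewrite H in E. discriminate.
Qed.

Lemma inv_inj (x y : W) : (forall g, inv x g = inv y g) -> x = y.
Proof.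
  intros H. apply gmul_eq1_iff, inv_trivial. intros g.
  rewrite inv_mul, inv_inv, ginvV, H. apply xorb_nilpotent.
Qed.

Lemma gen_ne1 (a : S) : s a <> gone.
Proof.
  intros E. pose proof (inv_gen_self a) as H. rewrite E, inv_one in H. discriminate.
Qed.

(** For central [z] the two terms of the cocycle rule for [z * z] coincide and cancel, so [z * z]
    has no inversions. *)
Lemma central_invol (z : W) : (forall w, z * w = w * z) -> z * z = gone.
Proof.
  intros H. apply inv_trivial. intros g. rewrite inv_mul.
  replace (z^-1 * g * z) with g; [apply xorb_nilpotent|].
  rewrite gmulA', <- H. grp.
Qed.

Lemma refl_conj (l : list S) (g : W) : In g (refl l) ->
  exists u a, In a l /\ par (fun b => In b l) u /\ g = u * s a * u^-1.
Proof.
  revert g. induction l as [|a l IH]; intros g; simpl; [tauto|].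
  intros [<-|H].
  - exists gone, a. split; [auto|split; [apply sub_one, gen_subgroup|grp]].
  - apply in_map_iff in H. destruct H as (t & <- & Ht).
    destruct (IH t Ht) as (u & b & Hb & Hu & ->). exists (s a * u), b.
    split; [auto|split; [|grp]].
    apply sub_mul; [apply gen_subgroup|apply par_gen; auto|].
    revert Hu. apply par_mono. auto.
Qed.

(** Finitely many elements use a finite set [L] of letters. A reduced word over [L] for [s a] can
    cross only the wall of [s a], so its first letter is [a], and [a] belongs to [L]. *)
Lemma fg_rank_finite : finitely_generated W -> finite (fun _ : S => True).
Proof.
  intros (lw & Hlw).
  assert (HL : exists L, forall w, In w lw -> par (fun a => In a L) w).
  { clear Hlw. induction lw as [|w lw (L & HL)].
    - exists []. simpl. tauto.
    - destruct (par_word _ w (par_full w)) as (l & _ & <-). exists (l ++ L).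
      intros x [<-|Hx].
      + apply par_ev, Forall_forall. intros a Ha. apply in_or_app. auto.
      + apply (par_mono (fun a => In a L)); [|auto]. intros a Ha. apply in_or_app. auto. }
  destruct HL as (L & HL). exists L. intros a _.
  assert (Ha : par (fun a => In a L) (s a)).
  { apply (generates_sub W _ _ Hlw); [apply gen_subgroup|exact HL]. }
  destruct (reduced_exists _ _ Ha) as (l & Hl).
  assert (All : forall g, In g (refl l) -> g = s a).
  { intros g Hg. apply (reduced_inv _ _ _ _ Hl) in Hg. rewrite inv_gen in Hg.
    apply dec_elim, Hg. }
  destruct l as [|b l].
  - exfalso. apply (gen_ne1 a). symmetry. apply Hl.
  - assert (E : s b = s a) by (apply All; simpl; auto). apply s_inj in E. subst b.
    destruct Hl as (H1 & _). inversion H1. assumption.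
Qed.

(** * Finite normal subgroups *)

Section FiniteNormal.
Variable K : W -> Prop.
Hypotheses (Ksub : subgroup W K) (Knormal : normal W K) (Kfin : finite K).

Definition cut (r : W) : Prop := exists w, K w /\ inv w r = true.

Lemma cut_finite : finite cut.
Proof.
  destruct Kfin as (l & Hl).
  assert (H : forall l', finite (fun r => exists w : W, In w l' /\ inv w r = true)).
  { induction l' as [|w l' (lr & IH)].
    - exists []. intros r (w & [] & _).
    - destruct (par_word _ w (par_full w)) as (lw & _ & E). exists (refl lw ++ lr).
      intros r (x & [<-|Hx] & Hr); apply in_or_app.
      + left. apply inv_ev_in. rewrite E. exact Hr.
      + right. eauto. }
  destruct (H l) as (lr & Hlr). exists lr. intros r (w & Hw & Hr). apply Hlr. eauto.
Qed.

Lemma conj_gen_K (w : W) (a : S) : K w -> K (s a * w * s a).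
Proof. intros H. rewrite <- (s_inv a) at 2. apply Knormal, H. Qed.

Lemma cut_conj_gen (a : S) (r : W) : cut r -> cut (s a * r * s a).
Proof.
  intros (w & Hw & Hr).
  pose proof (conj_gen_K w a Hw) as Hu. set (u := s a * w * s a) in *.
  destruct (classic (r = s a)) as [->|E].
  { exists w. split; [exact Hw|]. replace (s a * s a * s a) with (s a) by grp. exact Hr. }
  (* In the first case the last factor [s a] of [u] disturbs the count; then exactly one of [u] and
     [u * w^-1], both in [K], has the inversion [s a * r * s a]. *)
  destruct (classic (w^-1 * r * w = s a)) as [E'|E'].
  - assert (Er : r = w * s a * w^-1) by (rewrite <- E'; grp).
    assert (C : inv (u * w^-1) (s a * r * s a) = xorb (inv u (s a * r * s a)) true).
    { rewrite inv_mul. f_equal. rewrite <- Hr, inv_inv. f_equal.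
      rewrite Er. unfold u. grp. }
    destruct (inv u (s a * r * s a)) eqn:D.
    + exists u. auto.
    + exists (u * w^-1). split; [|exact C]. apply sub_mul; auto. apply sub_inv; auto.
  - exists u. split; [exact Hu|]. unfold u. rewrite !inv_mul, !inv_gen.
    rewrite (dec_false (s a * r * s a = s a)), (dec_false (_ = s a)).
    + replace ((s a)^-1 * (s a * r * s a) * s a) with r by grp. rewrite Hr. reflexivity.
    + intros H. apply E'. rewrite <- H. grp.
    + intros H. apply E. replace r with (s a * (s a * r * s a) * s a) by grp. rewrite H. grp.
Qed.

Lemma cut_conj (u r : W) : cut (u * r * u^-1) <-> cut r.
Proof.
  revert r. apply (fun H => par_full u (fun u => forall r, cut (u * r * u^-1) <-> cut r) H).
  - split; [|split].
    + intros r. grp.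
    + intros x y Hx Hy r. rewrite <- (Hy r), <- (Hx (y * r * y^-1)). grp.
    + intros x Hx r. rewrite <- (Hx (x^-1 * r * x^-1^-1)). grp.
  - intros y (a & _ & <-) r. split; intros H.
    + apply cut_conj_gen with (a := a) in H.
      replace (s a * (s a * r * (s a)^-1) * s a) with r in H by grp. exact H.
    + rewrite s_inv. apply cut_conj_gen, H.
Qed.

(** With [w' = s b * w * s b] in [K], the two expressions [s b * w = w' * s b] are compared at the
    reflection [w' * s b * w'^-1]. Neither [w] nor [w'] inverts a conjugate of [s b], so the
    comparison forces this reflection to be [s b]. *)
Lemma comm_of_not_cut (b : S) (w : W) : ~ cut (s b) -> K w -> w * s b = s b * w.
Proof.
  intros Hb Hw. pose proof (conj_gen_K w b Hw) as Hw'. set (w' := s b * w * s b) in *.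
  assert (NC : forall x u, K x -> inv x (u * s b * u^-1) = false).
  { intros x u Hx. apply not_true_is_false. intros H. apply Hb, (cut_conj u). exists x. auto. }
  assert (E : inv (s b * w) (w' * s b * w'^-1) = inv (w' * s b) (w' * s b * w'^-1)).
  { f_equal. unfold w'. grp. }
  rewrite !inv_mul, !inv_gen, NC in E by auto.
  replace (inv w ((s b)^-1 * (w' * s b * w'^-1) * s b)) with false in E.
  2: { rewrite <- (NC w (s b * w')) by auto. f_equal. grp. }
  rewrite (dec_true (w'^-1 * (w' * s b * w'^-1) * w' = s b)) in E by grp.
  rewrite xorb_false_r in E. apply dec_elim in E.
  assert (E2 : s b * w * s b * s b * (s b * w * s b)^-1 = s b) by exact E.
  apply (gmul_cancel_r _ (w^-1)). transitivity (s b); [|grp].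
  replace (w * s b * w^-1) with (s b * (s b * w * s b * s b * (s b * w * s b)^-1) * s b) by grp.
  rewrite E2. grp.
Qed.

(* Otherwise [tst] would be an inversion of some [w] in [K] that commutes with [t = s b],
   so [tstw] is shorter than [w]; but [n |-> (ts)n(ts)^-1] for [n <> s], and [s |-> t],
   maps the inversions of [w] injectively into those of [tstw]. *)
Lemma cut_comm (a b : S) : cut (s a) -> ~ cut (s b) -> s a * s b = s b * s a.
Proof.
  intros Ha Hb. apply NNPP. intros Hab.
  destruct Ha as (w & Hw & Hwa).
  assert (Ha : cut (s a)) by (exists w; auto).
  pose proof (comm_of_not_cut b w Hb Hw) as Hcomm.
  assert (NC : forall x u, K x -> inv x (u * s b * u^-1) = false).
  { intros x u Hx. apply not_true_is_false. intros H. apply Hb, (cut_conj u). exists x. auto. }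
  assert (Ht : forall g, inv w (s b * g * s b) = inv w g).
  { intros g. assert (E : inv (s b * w) g = inv (w * s b) g) by (rewrite Hcomm; reflexivity).
    rewrite !inv_mul, !inv_gen in E.
    replace (dec (w^-1 * g * w = s b)) with (dec (g = s b)) in E.
    - rewrite s_inv in E. rewrite (xorb_comm (inv w g)) in E.
      destruct (dec (g = s b)), (inv w (s b * g * s b)), (inv w g); simpl in E; congruence.
    - apply dec_iff. split; intros H.
      + rewrite H, gmulA', <- Hcomm. grp.
      + replace g with (w * (w^-1 * g * w) * w^-1) by grp. rewrite H, Hcomm. grp. }
  destruct (reduced_exists _ w (par_full w)) as (l & Hl).
  assert (Hin : In (s b * s a * s b) (refl l)).
  { apply (reduced_inv _ _ _ _ Hl). rewrite Ht. exact Hwa. }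
  destruct (exchange _ _ Hin) as (l' & L1 & L2 & _).
  assert (Ew : ev l = w) by apply Hl. rewrite Ew in L2.
  set (phi := fun n => if excluded_middle_informative (n = s a) then s b
                       else s b * s a * n * s a * s b).
  assert (P1 : forall n, inv w n = true -> n <> s a -> s b * s a * n * s a * s b <> s b).
  { intros n Hn Hna E. apply Hb, (cut_conj (s b * s a)^-1). exists w. split; auto.
    rewrite <- Hn. f_equal.
    replace n with (s a * s b * (s b * s a * n * s a * s b) * s b * s a) by grp.
    rewrite E. grp. }
  assert (ND : NoDup (map phi (refl l))).
  { apply NoDup_map_NoDup_ForallPairs; [|apply (reduced_NoDup _ _ _ Hl)].
    intros x y Hx Hy. apply (reduced_inv _ _ _ _ Hl) in Hx, Hy. unfold phi.
    destruct excluded_middle_informative as [->|Nx];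
      destruct excluded_middle_informative as [->|Ny]; intros E; auto.
    - exfalso. apply (P1 y); auto.
    - exfalso. apply (P1 x); auto.
    - apply (gmul_cancel_l _ (s b * s a)), (gmul_cancel_r _ (s a * s b)).
      rewrite !gmulA in *. exact E. }
  assert (Inc : incl (map phi (refl l)) (refl l')).
  { intros g Hg. apply in_map_iff in Hg. destruct Hg as (n & <- & Hn).
    apply (reduced_inv _ _ _ _ Hl) in Hn. apply inv_ev_in. rewrite L2.
    rewrite !gmulA', !inv_mul, !inv_gen, !s_inv. unfold phi.
    destruct excluded_middle_informative as [->|Nn].
    - rewrite (dec_true (s b = s b)) by reflexivity.
      rewrite (dec_false (s b * s b * s b = s a)), (dec_false (_ = s b)).
      + rewrite <- (NC w (s b * s a)) by exact Hw. simpl.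
        replace (s b * (s a * (s b * s b * s b) * s a) * s b) with (s b * s a * s b * (s b * s a)^-1) by grp.
        rewrite NC; auto.
      + intros E. apply Hab. rewrite <- E at 2. grp.
      + intros E. apply Hb. rewrite <- E in Ha.
        replace (s b * s b * s b) with (s b) in Ha by grp. exact Ha.
    - rewrite (dec_false (s b * s a * n * s a * s b = s b)) by auto.
      rewrite (dec_false (s b * _ * s b = s a)), (dec_false (_ = s b)).
      + simpl. rewrite <- Hn, <- (Ht n). f_equal. grp.
      + intros E. apply Hb. rewrite <- E. exists w. split; auto. rewrite <- Hn. f_equal. grp.
      + intros E. apply Nn.
        replace n with (s a * (s b * (s b * s a * n * s a * s b) * s b) * s a) by grp.
        rewrite E. grp. }
  pose proof (NoDup_incl_length ND Inc) as HL. rewrite length_map, !refl_length in HL. lia.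
Qed.

(** The inversions of an element of this subgroup are conjugates of cut generators, hence cut
    themselves. So its elements correspond to subsets of a finite set of reflections. *)
Lemma par_cut_finite : finite (par (fun a => cut (s a))).
Proof.
  destruct cut_finite as (lX & HX).
  apply (finite_inj _ (fun w => map (inv w) lX) (words [true; false] (length lX))).
  - intros w _. apply words_in. intros g _. destruct (inv w g); simpl; auto.
  - assert (H : forall w g, par (fun a => cut (s a)) w -> inv w g = true -> In g lX).
    { intros w g Hw Hg. apply HX. destruct (par_word _ _ Hw) as (l & Hl & <-).
      apply inv_ev_in, refl_conj in Hg. destruct Hg as (u & a & Ha & _ & ->).
      apply cut_conj. rewrite Forall_forall in Hl. apply Hl, Ha. }
    intros x y Hx Hy E. apply inv_inj. intros g.
    destruct (inv x g) eqn:Ex.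
    + rewrite <- Ex. apply (map_eq_on _ _ _ _ E). eauto.
    + symmetry. apply not_true_is_false. intros Ey.
      rewrite <- (map_eq_on _ _ _ g E), Ex in Ey; [discriminate|]. eauto.
Qed.

Lemma cut_nonempty (I : S -> Prop) (w : W) :
  K w -> par I w -> w <> gone -> exists a, I a /\ cut (s a).
Proof.
  intros Hw HI Hne. destruct (reduced_exists _ _ HI) as ([|a l] & Hl).
  - exfalso. apply Hne. symmetry. apply Hl.
  - exists a. split.
    + destruct Hl as (H & _). inversion H. assumption.
    + exists w. split; [exact Hw|]. apply (reduced_inv _ _ _ _ Hl). simpl. auto.
Qed.

End FiniteNormal.

(** * Splitting the diagram *)

(** No edge of the diagram leaves [I]. The condition is phrased by commutation because this is what
    [cut_comm] delivers; the labels enter only through their parity, in [separated_even]. *)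
Definition separated (I : S -> Prop) : Prop :=
  forall a b, I a -> ~ I b -> s a * s b = s b * s a.

(** For commuting involutions an odd power of [s a * s b] is [s a * s b] itself, so an odd label
    would give [s a = s b]. The label 0, which stands for infinity, counts as even. *)
Lemma separated_even (I : S -> Prop) (a b : S) :
  separated I -> I a -> ~ I b -> exists k, m a b = k + k.
Proof.
  intros HI Ha Hb. destruct (Nat.Even_or_Odd (m a b)) as [(k & E)|(k & E)].
  - exists k. lia.
  - exfalso. destruct pres as (_ & _ & _ & Hr & _).
    assert (E' : gpow W (s a * s b) (m a b) = gone) by (apply Hr; lia).
    rewrite E, gpow_comm_mul in E' by auto.
    replace (2 * k + 1) with (Datatypes.S (k + k)) in E' by lia.
    simpl in E'. rewrite !gpow_invol in E' by apply s_invol. rewrite !gmul1r in E'.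
    assert (a = b).
    { apply s_inj. rewrite <- (s_inv b). rewrite <- (ginvV W (s a)). f_equal.
      symmetry. apply ginv_unique. exact E'. }
    subst b. tauto.
Qed.

(** The universal property of [par I], obtained by killing the generators outside [I]: the mixed
    relations survive because [f a] is an involution and the mixed labels are even. *)
Lemma par_extend (I : S -> Prop) (H : group) (f : S -> H) : separated I ->
  (forall a b, I a -> I b -> m a b <> 0 -> gpow H (f a * f b) (m a b) = gone) ->
  exists phi : W -> H, is_hom W H phi /\
    (forall a, I a -> phi (s a) = f a) /\ (forall b, ~ I b -> phi (s b) = gone).
Proof.
  intros HI Hf. pose proof (rel_invol H f I Hf) as Hinv.
  pose proof pres as ((Hsym & _) & _ & _ & _ & Hu).
  assert (Cross : forall a b, I a -> ~ I b -> gpow H (f a) (m a b) = gone).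
  { intros a b Ha Hb. destruct (separated_even I a b HI Ha Hb) as (k & ->).
    apply gpow_invol. auto. }
  destruct (Hu H (fun a => if excluded_middle_informative (I a) then f a else gone))
    as (phi & Hphi & E).
  - intros a b Hab.
    destruct excluded_middle_informative as [Ha|Ha];
      destruct excluded_middle_informative as [Hb|Hb].
    + auto.
    + rewrite gmul1r. auto.
    + rewrite gmul1l, Hsym. auto.
    + rewrite gmul1l. induction (m a b) as [|n IH]; simpl; [reflexivity|].
      rewrite gmul1l. destruct n; [reflexivity|]. apply IH. discriminate.
  - exists phi. split; [exact Hphi|]. split; intros a Ha; rewrite E;
      destruct excluded_middle_informative; tauto.
Qed.

Lemma par_commute (I J : S -> Prop) :
  (forall a b, I a -> J b -> s a * s b = s b * s a) ->
  forall x y, par I x -> par J y -> x * y = y * x.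
Proof.
  intros H. apply gen_commute. intros x y (a & Ha & <-) (b & Hb & <-). auto.
Qed.

Lemma par_product (I J : S -> Prop) (w : W) :
  (forall a b, I a -> J b -> s a * s b = s b * s a) ->
  par (fun a => I a \/ J a) w -> exists x y, par I x /\ par J y /\ w = x * y.
Proof.
  intros H Hw. pose proof (par_commute I J H) as Hc.
  pose proof (gen_subgroup W (fun x => exists a, I a /\ s a = x)) as HI.
  pose proof (gen_subgroup W (fun x => exists a, J a /\ s a = x)) as HJ.
  apply Hw.
  - split; [|split].
    + exists gone, gone. repeat split; try (apply sub_one; assumption). grp.
    + intros w1 w2 (x1 & y1 & Hx1 & Hy1 & ->) (x2 & y2 & Hx2 & Hy2 & ->).
      exists (x1 * x2), (y1 * y2). split; [apply sub_mul; auto|split; [apply sub_mul; auto|]].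
      rewrite !gmulA'. f_equal. rewrite !gmulA. f_equal. symmetry. auto.
    + intros w1 (x1 & y1 & Hx1 & Hy1 & ->). exists (x1^-1), (y1^-1).
      split; [apply sub_inv; auto|split; [apply sub_inv; auto|]].
      rewrite Hc by auto. grp.
  - intros y (a & [Ha|Ha] & <-).
    + exists (s a), gone. split; [apply par_gen, Ha|split; [apply sub_one; auto|grp]].
    + exists gone, (s a). split; [apply sub_one; auto|split; [apply par_gen, Ha|grp]].
Qed.

Lemma separated_fac (I : S -> Prop) :
  separated I -> fac W (par I) (par (fun a => ~ I a)).
Proof.
  intros HI. split; [apply gen_subgroup|split; [apply gen_subgroup|split; [|split]]].
  - apply par_commute. exact HI.
  (* The retraction [rho] fixes [par I] pointwise and kills the other parabolic subgroup, so their
     intersection is trivial. *)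
  - destruct (par_extend I W s HI) as (rho & Hrho & H1 & H2).
    { intros a b _ _. destruct pres as (_ & _ & _ & Hr & _). apply Hr. }
    intros x Hx Hx'.
    assert (E1 : rho x = x).
    { apply (Hx (fun x => rho x = x)).
      - split; [apply hom_one, Hrho|split].
        + intros u v Hu Hv. rewrite Hrho. congruence.
        + intros u Hu. rewrite (hom_inv _ _ _ _ Hrho). congruence.
      - intros y (a & Ha & <-). auto. }
    rewrite <- E1. apply (Hx' (fun x => rho x = gone)).
    + split; [apply hom_one, Hrho|split].
      * intros u v Hu Hv. rewrite Hrho, Hu, Hv. grp.
      * intros u Hu. rewrite (hom_inv _ _ _ _ Hrho), Hu. grp.
    + intros y (a & Ha & <-). auto.
  - intros g. apply par_product; [exact HI|].
    apply (par_mono (fun _ => True)); [|apply par_full]. intros a _. apply classic.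
Qed.

Lemma separated_compl (I : S -> Prop) : separated I -> separated (fun a => ~ I a).
Proof. intros HI a b Ha Hb. symmetry. apply HI; [apply NNPP|]; auto. Qed.

Lemma par_coxeter (I : S -> Prop) (HI : subgroup W (par I)) : separated I ->
  coxeter_presentation (sub W (par I) HI) {a | I a}
    (fun a => exist _ (s (proj1_sig a)) (par_gen I _ (proj2_sig a)))
    (fun a b => m (proj1_sig a) (proj1_sig b)).
Proof.
  intros HIs. pose proof pres as ((Hsym & H1) & Hinj & _ & Hr & _).
  split; [split|split; [|split; [|split]]].
  - intros a b. apply Hsym.
  - intros a b. rewrite H1. split; [apply sig_eq|congruence].
  - intros a b E. apply sig_eq, Hinj. apply (f_equal (@proj1_sig _ _)) in E. exact E.
  - intros Q HQ Q1 QM QV [w Hw].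
    assert (Hq : exists q, Q q /\ proj1_sig q = w).
    { destruct (par_word _ _ Hw) as (l & Hl & E). revert w Hw E.
      induction Hl as [|a l Ha Hl IH]; intros w Hw E; simpl in E; subst w.
      - exists gone. split; [exact Q1|reflexivity].
      - destruct (IH (ev l) (par_ev _ _ Hl) eq_refl) as (q & Hq & <-).
        exists (@gmul (sub W (par I) HI) (exist _ (s a) (par_gen I a Ha)) q).
        split; [|reflexivity]. apply QM; [|exact Hq]. apply HQ.
        exists (exist _ a Ha). reflexivity. }
    destruct Hq as (q & Hq & E).
    refine (eq_ind q Q Hq _ _). apply sig_eq. exact E.
  - intros a b Hab. apply sig_eq.
    rewrite (hom_pow _ _ _ _ _ (sub_val_hom W (par I) HI)). apply Hr, Hab.
  - intros H f Hf.
    set (f' := fun a => match excluded_middle_informative (I a) with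
                        | left h => f (exist _ a h) | right _ => gone end).
    assert (E : forall a, f a = f' (proj1_sig a)).
    { intros [a Ha]. unfold f'. simpl. destruct excluded_middle_informative; [|tauto].
      f_equal. apply sig_eq. reflexivity. }
    destruct (par_extend I H f' HIs) as (phi & Hphi & Ep & _).
    + intros a b Ha Hb. specialize (Hf (exist _ a Ha) (exist _ b Hb)).
      rewrite !E in Hf. exact Hf.
    + exists (fun x => phi (proj1_sig x)). split.
      * intros x y. apply Hphi.
      * intros a. simpl. rewrite Ep by apply proj2_sig. symmetry. apply E.
Qed.

(** A largest [I] works: if a nontrivial finite normal [K] lay in the complementary parabolic
    subgroup, the cut generators outside [I] could be added. They exist by [cut_nonempty], commute
    with all remaining generators by [cut_comm], and generate a finite group by [par_cut_finite]. *)
Lemma finite_part : finite (fun _ : S => True) ->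
  exists I, separated I /\ finite (par I) /\
    forall K : W -> Prop, subgroup W K -> normal W K -> finite K ->
      (forall x, K x -> par (fun a => ~ I a) x) -> forall x, K x -> x = gone.
Proof.
  intros (L & HL).
  assert (H : forall n I, separated I -> finite (par I) ->
    length (filter (fun a => dec (~ I a)) L) <= n ->
    exists I, separated I /\ finite (par I) /\
    forall K : W -> Prop, subgroup W K -> normal W K -> finite K ->
      (forall x, K x -> par (fun a => ~ I a) x) -> forall x, K x -> x = gone).
  { induction n as [n IH] using lt_wf_ind. intros I HI Hfin Hn.
    apply NNPP. intros Hno.
    apply Hno. exists I. split; [exact HI|split; [exact Hfin|]].
    intros K K1 K2 K3 K4 x Hx. apply NNPP. intros Hx1. apply Hno.
    destruct (cut_nonempty K (fun a => ~ I a) x Hx (K4 x Hx) Hx1) as (a & Ha & Hac).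
    set (J := fun a => ~ I a /\ cut K (s a)).
    assert (HIJ : separated (fun a => I a \/ J a)).
    { intros b c [Hb|[Hb Hb']] Hc; [apply HI; tauto|].
      apply (cut_comm K K1 K2); [exact Hb'|]. unfold J in Hc. tauto. }
    apply (IH (length (filter (fun a => dec (~ (I a \/ J a))) L))) with (I := fun a => I a \/ J a).
    - apply Nat.lt_le_trans with (2 := Hn). apply filter_length_lt with (a := a).
      + intros b Hb. apply dec_elim in Hb. apply dec_true. tauto.
      + auto.
      + apply dec_true, Ha.
      + apply dec_false. unfold J. tauto.
    - exact HIJ.
    - destruct Hfin as (l & Hl). destruct (par_cut_finite K K1 K2 K3) as (l' & Hl').
      exists (map (fun xy => fst xy * snd xy) (list_prod l l')). intros w Hw.
      apply par_product in Hw; [|intros b c Hb [Hc _]; auto].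
      destruct Hw as (u & v & Hu & Hv & ->). apply in_map_iff. exists (u, v).
      split; [reflexivity|]. apply in_prod; [auto|]. apply Hl'.
      revert Hv. apply par_mono. intros b [_ Hb]. exact Hb.
    - lia. }
  apply (H (length (filter (fun a => dec (~ False)) L)) (fun _ => False)); auto.
  - intros a b [].
  - exists [gone]. intros x Hx. left. apply (Hx (fun x => gone = x)).
    + split; [reflexivity|split].
      * intros u v <- <-. grp.
      * intros u <-. grp.
    + intros y (a & [] & _).
Qed.

(** * Finiteness of the set of direct factors *)

Lemma no_finite_normal_centerless : no_finite_normal W -> centerless W.
Proof.
  intros H z Hz. apply (H (fun x => x = gone \/ x = z)); [| |exists [gone; z]|auto].
  - pose proof (central_invol z Hz) as E. split; [auto|split].
    + intros x y [->| ->] [->| ->]; grp; auto.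
    + intros x [->| ->]; [left; grp|right]. symmetry. apply ginv_unique, E.
  - intros g x [->| ->]; [left; grp|right]. rewrite <- Hz. grp.
  - intros x [->| ->]; simpl; auto.
Qed.

(** On the centralizer of [r] the map [inv _ r] is a homomorphism to the group of order two; for a
    reflection [r] it records the sign by which an element acts on the root of [r]. *)
Lemma inv_commuting_mul (c d r : W) :
  c * r = r * c -> inv (c * d) r = xorb (inv c r) (inv d r).
Proof. intros H. rewrite inv_mul. do 2 f_equal. rewrite gmulA', <- H. grp. Qed.

(** Both sides of [c * b = b * c] are evaluated at [b * r * b^-1]. If [c] inverts [r], all
    conjugates of [r] by elements commuting with [c] thus lie in the finite inversion set of [c]. *)
Lemma inv_commuting_conj (b c r : W) :
  c * r = r * c -> c * b = b * c -> inv c (b * r * b^-1) = inv c r.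
Proof.
  intros Hr Hb. set (g := b * r * b^-1).
  assert (Hg : c * g = g * c).
  { unfold g. symmetry. repeat apply comm_mul; auto. apply comm_inv. auto. }
  assert (E : inv (c * b) g = inv (b * c) g) by (rewrite Hb; reflexivity).
  rewrite inv_commuting_mul in E by exact Hg. rewrite inv_mul in E.
  replace (b^-1 * g * b) with r in E by (unfold g; grp).
  destruct (inv c g), (inv c r), (inv b g); simpl in E; congruence.
Qed.

Definition factor_type (p : (W -> Prop) * (W -> Prop)) (a : S) : bool :=
  dec (exists x y, fst p x /\ snd p y /\ s a = x * y /\ inv x (s a) = true).

Lemma factor_type_eq (A B : W -> Prop) (a : S) (x y : W) :
  fac W A B -> A x -> B y -> s a = x * y -> factor_type (A, B) a = inv x (s a).
Proof.
  intros F Hx Hy E. unfold factor_type. simpl. destruct (inv x (s a)) eqn:Ei.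
  - apply dec_true. exists x, y. auto.
  - apply dec_false. intros (x' & y' & Hx' & Hy' & E' & Ei').
    rewrite E in E' at 1. destruct (fac_uniq W A B _ _ _ _ F Hx Hx' Hy Hy' E') as [<- _].
    congruence.
Qed.

(* Write [s a] as a product of its components in [A ∩ C], [A ∩ D], [B ∩ C], [B ∩ D]. An odd
   number of them negate the root of [s a], and equality of the types forces the first or the
   last to do so; both commute with [A ∩ D]. *)
Lemma same_type_witness (A B C D : W -> Prop) (a : S) : centerless W ->
  fac W A B -> fac W C D -> factor_type (A, B) a = factor_type (C, D) a ->
  exists c, c * s a = s a * c /\ inv c (s a) = true /\
    forall b, A b -> D b -> c * b = b * c.
Proof.
  intros HZ FAB FCD HT.
  pose proof FAB as (_ & _ & cAB & _ & sAB). pose proof FCD as (_ & _ & cCD & _ & _).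
  destruct (fac_proj W C D FCD) as (p & q & Hp & Hq & HC & HD & Hpq & _).
  destruct (sAB (s a)) as (x & y & Hx & Hy & E).
  assert (R1 := fun z => fac_refine W A B C D p q z HZ FAB FCD Hp HC HD Hpq).
  assert (R2 := fun z => fac_refine W B A C D p q z HZ (fac_sym W _ _ FAB) FCD Hp HC HD Hpq).
  assert (Hqp : forall g, g = q g * p g) by (intros g; rewrite (Hpq g) at 1; auto).
  assert (R3 := fun z => fac_refine W A B D C q p z HZ FAB (fac_sym W _ _ FCD) Hq HD HC Hqp).
  assert (R4 := fun z => fac_refine W B A D C q p z HZ (fac_sym W _ _ FAB)
                           (fac_sym W _ _ FCD) Hq HD HC Hqp).
  rewrite (factor_type_eq A B a x y FAB Hx Hy E) in HT.
  assert (E' : s a = p x * p y * (q x * q y)).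
  { rewrite <- Hp, <- Hq, <- Hpq. exact E. }
  rewrite (factor_type_eq C D a (p x * p y) (q x * q y) FCD) in HT.
  2,3: rewrite <- ?Hp, <- ?Hq; auto.
  2: exact E'.
  set (r := s a) in *.
  assert (c1 : p x * r = r * p x).
  { rewrite E'. symmetry. repeat apply comm_mul; auto; symmetry; auto. }
  assert (c2 : q x * r = r * q x).
  { rewrite E'. symmetry. repeat apply comm_mul; auto; symmetry; auto. }
  assert (c3 : p y * r = r * p y).
  { rewrite E'. symmetry. repeat apply comm_mul; auto; symmetry; auto. }
  assert (Hr : inv r r = true) by apply inv_gen_self.
  rewrite E' in Hr at 1. rewrite gmulA' in Hr.
  rewrite (Hpq x) in HT at 1.
  rewrite !inv_commuting_mul in Hr by assumption.
  rewrite !inv_commuting_mul in HT by assumption.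
  destruct (inv (p x) r) eqn:E1.
  - exists (p x). repeat split; auto.
  - exists (q y). repeat split.
    + rewrite E'. symmetry. repeat apply comm_mul; auto; symmetry; auto.
    + destruct (inv (q x) r), (inv (p y) r), (inv (q y) r); simpl in *; congruence.
    + intros b Hb _. symmetry. auto.
Qed.

(** The witnesses of [same_type_witness] leave each generator only finitely many conjugates under
    [A ∩ D]. As the center is trivial, an element is determined by how it conjugates the generators,
    so the normal subgroup [A ∩ D] is finite and therefore trivial. *)
Lemma same_type_disjoint (A B C D : W -> Prop) :
  finite (fun _ : S => True) -> no_finite_normal W ->
  fac W A B -> fac W C D -> (forall a, factor_type (A, B) a = factor_type (C, D) a) ->
  forall x, A x -> D x -> x = gone.
Proof.
  intros (L & HL) HN FAB FCD HT.
  pose proof (no_finite_normal_centerless HN) as HZ.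
  pose proof FAB as (HA & _). pose proof FCD as (_ & HD & _).
  assert (Y : forall l, exists Y, forall a b, In a l -> A b -> D b -> In (b * s a * b^-1) Y).
  { induction l as [|a l (Y & HY)].
    - exists []. simpl. tauto.
    - destruct (same_type_witness A B C D a HZ FAB FCD (HT a)) as (c & Hc & Hi & Hb).
      destruct (par_word _ c (par_full c)) as (lc & _ & Ec). exists (refl lc ++ Y).
      intros a' b [<-|Ha'] HAb HDb; apply in_or_app; [left|right; auto].
      apply inv_ev_in. rewrite Ec, inv_commuting_conj; auto. }
  destruct (Y L) as (Y0 & HY0).
  intros x HAx HDx. apply (HN (fun x => A x /\ D x)); [| | |auto].
  - split; [split; apply sub_one; assumption|split].
    + intros u v [] []. split; apply sub_mul; auto.
    + intros u []. split; apply sub_inv; auto.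
  - intros g u [HAu HDu]. split.
    + apply (fac_normal W A B FAB g u HAu).
    + apply (fac_normal W D C (fac_sym W _ _ FCD) g u HDu).
  - apply (finite_inj _ (fun b => map (fun a => b * s a * b^-1) L) (words Y0 (length L))).
    + intros b [HAb HDb]. apply words_in. auto.
    + intros b b' _ _ E. symmetry. apply gmul_eq1_iff, HZ. intros w.
      apply (par_full w (fun w => b'^-1 * b * w = w * (b'^-1 * b))).
      * pose proof (centralizer_subgroup W (fun z => z = b'^-1 * b)) as (H1 & H2 & H3).
        split; [grp|split].
        -- intros u v Hu Hv. symmetry. apply comm_mul; auto.
        -- intros u Hu. symmetry. apply comm_inv. auto.
      * intros y (a & _ & <-).
        pose proof (map_eq_on _ _ _ a E (HL a I)) as Ea. simpl in Ea.
        transitivity (b'^-1 * (b * s a * b^-1) * b); [grp|]. rewrite Ea. grp.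
Qed.

(** Decompositions of equal type coincide: by [fac_refine] the [D]-component of an element of [A]
    lies in [A ∩ D], which is trivial, so [A] is contained in [C]; the other inclusions are
    symmetric. *)
Lemma finite_factors : finite (fun _ : S => True) -> no_finite_normal W ->
  finite (fun p : (W -> Prop) * (W -> Prop) => fac W (fst p) (snd p)).
Proof.
  intros HS HN. pose proof HS as (L & HL).
  apply (finite_inj _ (fun p => map (factor_type p) L) (words [true; false] (length L))).
  - intros p _. apply words_in. intros a _. destruct (factor_type p a); simpl; auto.
  - intros [A B] [C D] FAB FCD E. simpl in FAB, FCD.
    assert (HT : forall a, factor_type (A, B) a = factor_type (C, D) a).
    { intros a. apply (map_eq_on _ _ _ a E). auto. }
    assert (HT' : forall a, factor_type (C, D) a = factor_type (A, B) a) by (intros; auto).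
    pose proof (same_type_disjoint A B C D HS HN FAB FCD HT) as AD.
    pose proof (same_type_disjoint C D A B HS HN FCD FAB HT') as CB.
    assert (Sub : forall A B C D : W -> Prop, fac W C D ->
      (forall x, A x -> D x -> x = gone) -> (forall x, C x -> B x -> x = gone) ->
      fac W A B -> forall x, A x -> C x).
    { clear - pres HN. intros A B C D FCD AD CB FAB x Hx.
      pose proof (no_finite_normal_centerless HN) as HZ.
      destruct (fac_proj W C D FCD) as (p & q & Hp & Hq & HC & HD & Hpq & _).
      assert (Hqp : forall g, g = q g * p g).
      { intros g. rewrite (Hpq g) at 1. destruct FCD as (_ & _ & c & _). auto. }
      assert (Hqx : A (q x)).
      { apply (fac_refine W A B D C q p x HZ FAB (fac_sym W _ _ FCD)); auto. }
      rewrite (Hpq x), (AD (q x)), gmul1r by auto. auto. }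
    f_equal; apply functional_extensionality; intros x; apply propositional_extensionality; split.
    + apply (Sub A B C D); auto.
    + apply (Sub C D A B); auto.
    + apply (Sub B A D C); auto using fac_sym.
    + apply (Sub D C B A); auto using fac_sym.
Qed.
End Coxeter.

(** * Products of Coxeter groups *)

Lemma gen_proj (G : group) (M : G -> Prop) (HM : subgroup G M)
  (P : sub G M HM -> Prop) (Q : G -> Prop) :
  generates (sub G M HM) P -> subgroup G Q -> (forall x, P x -> Q (proj1_sig x)) ->
  forall x, M x -> Q x.
Proof.
  intros HP HQ H x Hx. change (Q (proj1_sig (exist M x Hx))).
  apply (generates_sub _ P (fun y => Q (proj1_sig y)) HP); [|exact H].
  split; [apply (sub_one _ _ HQ)|split].
  - intros u v. apply (sub_mul _ _ _ _ HQ).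
  - intros u. apply (sub_inv _ _ _ HQ).
Qed.

Lemma fac_proj_sub (G : group) (M N : G -> Prop) (HM : subgroup G M) (HN : subgroup G N) :
  fac G M N -> exists (p : G -> sub G M HM) (q : G -> sub G N HN),
    is_hom G (sub G M HM) p /\ is_hom G (sub G N HN) q /\
    (forall g, g = proj1_sig (p g) * proj1_sig (q g)) /\
    (forall x y, p (proj1_sig x * proj1_sig y) = x /\ q (proj1_sig x * proj1_sig y) = y).
Proof.
  intros F. destruct (fac_proj G M N F) as (p & q & Hp & Hq & HpM & HqN & E & U).
  exists (fun g => exist _ (p g) (HpM g)), (fun g => exist _ (q g) (HqN g)).
  split; [intros x y; apply sig_eq, Hp|]. split; [intros x y; apply sig_eq, Hq|].
  split; [exact E|]. intros [x Hx] [y Hy]. destruct (U x y Hx Hy) as [U1 U2].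
  split; apply sig_eq; simpl; auto.
Qed.

Lemma fac_coxeter (G : group) (M N : G -> Prop) (HM : subgroup G M) (HN : subgroup G N) :
  fac G M N -> is_coxeter_group (sub G M HM) -> is_coxeter_group (sub G N HN) ->
  is_coxeter_group G.
Proof.
  intros F (A & s & m & PA) (B & t & n & PB).
  pose proof F as (_ & _ & Hc & Hi & Hs).
  pose proof (gen_ne1 _ _ _ _ PA) as NA. pose proof (gen_ne1 _ _ _ _ PB) as NB.
  pose proof (s_invol _ _ _ _ PA) as IA. pose proof (s_invol _ _ _ _ PB) as IB.
  pose proof (fun H f h => rel_invol _ _ _ _ PA H f (fun _ => True) h) as RA.
  pose proof (fun H f h => rel_invol _ _ _ _ PB H f (fun _ => True) h) as RB.
  destruct PA as ((symA & oneA) & injA & genA & relA & univA).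
  destruct PB as ((symB & oneB) & injB & genB & relB & univB).
  assert (X : forall a b, proj1_sig (s a) <> proj1_sig (t b)).
  { intros a b E. apply (NA a), sig_eq. simpl. apply Hi; [apply proj2_sig|].
    rewrite E. apply proj2_sig. }
  exists (A + B)%type,
    (fun c => match c with inl a => proj1_sig (s a) | inr b => proj1_sig (t b) end),
    (fun c d => match c, d with
                | inl a, inl b => m a b | inr a, inr b => n a b | _, _ => 2 end).
  split; [split|split; [|split; [|split]]].
  - intros [a|a] [b|b]; auto.
  - intros [a|a] [b|b]; rewrite ?oneA, ?oneB; split; congruence.
  - intros [a|a] [b|b] E.
    + f_equal. apply injA, sig_eq, E.
    + destruct (X _ _ E).
    + symmetry in E. destruct (X _ _ E).
    + f_equal. apply injB, sig_eq, E.
  - intros Q HQ Q1 QM QV x. destruct (Hs x) as (u & v & Hu & Hv & ->).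
    assert (HQs : subgroup G Q) by (split; auto).
    apply QM.
    + apply (gen_proj G M HM _ Q genA HQs); [|exact Hu].
      intros y (a & <-). apply HQ. exists (inl a). reflexivity.
    + apply (gen_proj G N HN _ Q genB HQs); [|exact Hv].
      intros y (a & <-). apply HQ. exists (inr a). reflexivity.
  - assert (X2 : forall a b, gpow G (proj1_sig (s a) * proj1_sig (t b)) 2 = gone).
    { intros a b. simpl. rewrite gmul1r, gmulA', (gmulA G (proj1_sig (t b))).
      rewrite <- (Hc (proj1_sig (s a)) (proj1_sig (t b))) by apply proj2_sig.
      rewrite (gmulA' G (proj1_sig (s a))), (gmulA G (proj1_sig (s a))).
      change (proj1_sig (s a * s a) * proj1_sig (t b * t b) = gone).
      rewrite IA, IB. apply gmul1l. }
    intros [a|a] [b|b] H.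
    + rewrite <- (hom_pow _ _ _ (s a * s b) _ (sub_val_hom G M HM)), relA; auto.
    + apply X2.
    + rewrite <- (X2 b a). f_equal. symmetry. apply Hc; apply proj2_sig.
    + rewrite <- (hom_pow _ _ _ (t a * t b) _ (sub_val_hom G N HN)), relB; auto.
  - intros H f Hf.
    assert (HfA : coxeter_relations A m H (fun a => f (inl a))).
    { intros a b. apply (Hf (inl a) (inl b)). }
    assert (HfB : coxeter_relations B n H (fun a => f (inr a))).
    { intros a b. apply (Hf (inr a) (inr b)). }
    destruct (univA H _ HfA) as (phi & Hphi & Ephi).
    destruct (univB H _ HfB) as (psi & Hpsi & Epsi).
    destruct (fac_proj_sub G M N HM HN F) as (p & q & Hp & Hq & E & U).
    assert (C : forall u v, phi u * psi v = psi v * phi u).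
    { intros u v. revert u.
      apply (generates_sub _ _ (fun u => phi u * psi v = psi v * phi u) genA).
      - destruct (centralizer_subgroup H (fun z => z = psi v)) as (C1 & C2 & C3).
        split; [rewrite (hom_one _ _ _ Hphi); grp|split].
        + intros x y Hx Hy. rewrite Hphi. apply comm_mul; auto.
        + intros x Hx. rewrite (hom_inv _ _ _ _ Hphi). apply comm_inv; auto.
      - intros x (a & <-). revert v.
        apply (generates_sub _ _ (fun v => phi (s a) * psi v = psi v * phi (s a)) genB).
        + split; [rewrite (hom_one _ _ _ Hpsi); grp|split].
          * intros x y Hx Hy. rewrite Hpsi. symmetry. apply comm_mul; auto.
          * intros x Hx. rewrite (hom_inv _ _ _ _ Hpsi). symmetry. apply comm_inv; auto.
        + intros y (b & <-). rewrite Ephi, Epsi. apply invol_comm.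
          * apply (RA H (fun a => f (inl a))); auto.
          * apply (RB H (fun a => f (inr a))); auto.
          * specialize (Hf (inl a) (inr b)). simpl in Hf. rewrite gmul1r in Hf. apply Hf. lia. }
    exists (fun g => phi (p g) * psi (q g)). split.
    + intros x y. rewrite Hp, Hq, Hphi, Hpsi, !gmulA'. f_equal. rewrite !gmulA. f_equal. apply C.
    + intros [a|b].
      * destruct (U (s a) (@gone (sub G N HN))) as [U1 U2].
        change (proj1_sig (@gone (sub G N HN))) with (@gone G) in U1, U2.
        rewrite gmul1r in U1, U2. rewrite U1, U2, Ephi.
        rewrite (hom_one _ _ _ Hpsi). apply gmul1r.
      * destruct (U (@gone (sub G M HM)) (t b)) as [U1 U2].
        change (proj1_sig (@gone (sub G M HM))) with (@gone G) in U1, U2.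
        rewrite gmul1l in U1, U2. rewrite U1, U2, Epsi.
        rewrite (hom_one _ _ _ Hphi). apply gmul1l.
Qed.

Lemma coxeter_iso (G H : group) (f : G -> H) : is_hom G H f ->
  (forall x y, f x = f y -> x = y) -> (forall y, exists x, f x = y) ->
  is_coxeter_group G -> is_coxeter_group H.
Proof.
  intros Hf Inj Sur (S & s & m & Hm & Hi & Hg & Hr & Hu).
  destruct (choice _ Sur) as (g & Hfg).
  assert (Hg' : is_hom H G g).
  { intros x y. apply Inj. rewrite Hf, !Hfg. reflexivity. }
  exists S, (fun a => f (s a)), m. split; [exact Hm|split; [auto|split; [|split]]].
  - intros Q HQ Q1 QM QV y. rewrite <- (Hfg y). generalize (g y).
    apply (generates_sub _ _ (fun x => Q (f x)) Hg).
    + split; [rewrite (hom_one _ _ _ Hf); exact Q1|split].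
      * intros u v Hx Hy. rewrite Hf. auto.
      * intros u Hx. rewrite (hom_inv _ _ _ _ Hf). auto.
    + intros x (a & <-). apply HQ. eauto.
  - intros a b Hab. rewrite <- Hf, <- (hom_pow _ _ _ _ _ Hf), Hr by exact Hab.
    apply hom_one, Hf.
  - intros K k Hk. destruct (Hu K k Hk) as (phi & Hphi & E).
    exists (fun y => phi (g y)). split.
    + intros x y. rewrite Hg'. apply Hphi.
    + intros a. rewrite <- E. f_equal. apply Inj, Hfg.
Qed.

(** * Inheritance by direct factors *)

Lemma hom_surj_generates (G H : group) (f : G -> H) (P : G -> Prop) :
  is_hom G H f -> (forall y, exists x, f x = y) -> generates G P ->
  generates H (fun y => exists x, P x /\ f x = y).
Proof.
  intros Hf Sur HP Q HQ Q1 QM QV y. destruct (Sur y) as (x & <-). revert x.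
  apply (generates_sub _ _ (fun x => Q (f x)) HP).
  - split; [rewrite (hom_one _ _ _ Hf); exact Q1|split].
    + intros u v Hx Hy. rewrite Hf. auto.
    + intros u Hx. rewrite (hom_inv _ _ _ _ Hf). auto.
  - intros x Hx. apply HQ. eauto.
Qed.

Lemma generates_mono (G : group) (P Q : G -> Prop) :
  (forall x, P x -> Q x) -> generates G P -> generates G Q.
Proof. intros H HP R HR. apply HP. auto. Qed.

Lemma ftg_surj (G H : group) (f : G -> H) :
  is_hom G H f -> (forall y, exists x, f x = y) ->
  finitely_torsion_generated G -> finitely_torsion_generated H.
Proof.
  intros Hf Sur (l & Hl & Hg). exists (map f l). split.
  - intros y Hy. apply in_map_iff in Hy. destruct Hy as (x & <- & Hx).
    destruct (Hl x Hx) as (n & Hn & E). exists n. split; [exact Hn|].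
    rewrite <- (hom_pow _ _ _ _ _ Hf), E. apply hom_one, Hf.
  - eapply generates_mono; [|apply (hom_surj_generates _ _ _ _ Hf Sur Hg)].
    intros y (x & Hx & <-). apply in_map, Hx.
Qed.

(** The factor [M] is presented as the quotient by [N]. The last clause is the congruence that a
    formula has to define so that [trans] can speak about [M]. *)
Lemma fac_proj_surj (G : group) (M N : G -> Prop) (HM : subgroup G M) :
  fac G M N -> exists p : G -> sub G M HM,
    is_hom G (sub G M HM) p /\ (forall y, exists x, p x = y) /\
    forall u v, p u = p v <-> N (v^-1 * u).
Proof.
  intros F. pose proof F as (_ & HN & Hc & _ & _).
  destruct (fac_proj_sub G M N HM HN F) as (p & q & Hp & Hq & E & U).
  exists p. split; [exact Hp|]. split.
  - intros y. exists (proj1_sig y * proj1_sig (@gone (sub G N HN))). apply U.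
  - assert (K : forall g, p g = gone <-> N g).
    { intros g. split; intros H.
      - rewrite (E g), H. simpl. rewrite gmul1l. apply proj2_sig.
      - destruct (U (@gone (sub G M HM)) (exist _ g H)) as [U1 _]. simpl in U1. rewrite gmul1l in U1. exact U1. }
    intros u v. rewrite <- K, Hp, (hom_inv _ _ _ _ Hp), gmul_eq1_iff. split; auto.
Qed.

Lemma fac_ftg (G : group) (M N : G -> Prop) (HM : subgroup G M) :
  fac G M N -> finitely_torsion_generated G -> finitely_torsion_generated (sub G M HM).
Proof.
  intros F. destruct (fac_proj_surj G M N HM F) as (p & Hp & Sp & _).
  apply (ftg_surj _ _ p); assumption.
Qed.

(** A normal subgroup of [M] is normal in [G], since [N] centralizes it. *)
Lemma fac_no_finite_normal (G : group) (M N : G -> Prop) (HM : subgroup G M) : fac G M N ->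
  (forall K : G -> Prop, subgroup G K -> normal G K -> finite K ->
     (forall x, K x -> M x) -> forall x, K x -> x = gone) ->
  no_finite_normal (sub G M HM).
Proof.
  intros (_ & _ & Hc & _ & Hs) HG K K1 K2 (l & Hl) x Hx. apply sig_eq. simpl.
  apply (HG (fun g => exists y, K y /\ proj1_sig y = g)).
  - split; [exists gone; split; [apply (sub_one _ _ K1)|reflexivity]|split].
    + intros u v (y & Hy & <-) (z & Hz & <-). exists (y * z).
      split; [apply sub_mul; auto|reflexivity].
    + intros u (y & Hy & <-). exists (y^-1). split; [apply sub_inv; auto|reflexivity].
  - intros g u (y & Hy & <-). destruct (Hs g) as (a & b & Ha & Hb & ->).
    exists (@gmul (sub G M HM) (@gmul (sub G M HM) (exist _ a Ha) y) (@ginv (sub G M HM) (exist _ a Ha))).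
    split; [apply K2, Hy|]. simpl.
    transitivity (a * (b * proj1_sig y) * b^-1 * a^-1); [|grp].
    rewrite <- (Hc (proj1_sig y) b) by (try apply proj2_sig; assumption). grp.
  - exists (map (fun y : sub G M HM => proj1_sig y) l). intros u (y & Hy & <-).
    apply in_map_iff. exists y. auto.
  - intros u (y & _ & <-). apply proj2_sig.
  - exists x. auto.
Qed.

Lemma generated_list_fg (G : group) (S : Type) (s : S -> G) :
  generates G (fun x => exists a, s a = x) -> finite (fun _ : S => True) -> finitely_generated G.
Proof.
  intros Hg (L & HL). exists (map s L). eapply generates_mono; [|exact Hg].
  intros x (a & <-). apply in_map, HL. exact I.
Qed.

(** * Formulas *)

Lemma upd_eq (G : group) (e : nat -> G) (n : nat) (x : G) : upd G e n x n = x.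
Proof. unfold upd. rewrite Nat.eqb_refl. reflexivity. Qed.

Lemma upd_ne (G : group) (e : nat -> G) (n k : nat) (x : G) : k <> n -> upd G e n x k = e k.
Proof. intros H. unfold upd. apply Nat.eqb_neq in H. rewrite H. reflexivity. Qed.

Lemma teval_agree (G : group) (e e' : nat -> G) (t : term) :
  (forall k, tocc k t -> e k = e' k) -> teval G e t = teval G e' t.
Proof.
  induction t as [n| |t IHt u IHu|t IHt]; simpl; intros H.
  - apply H. reflexivity.
  - reflexivity.
  - rewrite IHt, IHu; auto.
  - rewrite IHt; auto.
Qed.

Lemma sat_agree (G : group) (p : formula) : forall e e' : nat -> G,
  (forall k, free_in k p -> e k = e' k) -> (sat G e p <-> sat G e' p).
Proof.
  induction p as [|t u|p IHp|p IHp q IHq|p IHp q IHq|p IHp q IHq|n p IHp|n p IHp];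
    simpl; intros e e' H.
  - tauto.
  - rewrite (teval_agree G e e' t), (teval_agree G e e' u) by auto. tauto.
  - rewrite (IHp e e') by auto. tauto.
  - rewrite (IHp e e'), (IHq e e') by auto. tauto.
  - rewrite (IHp e e'), (IHq e e') by auto. tauto.
  - rewrite (IHp e e'), (IHq e e') by auto. tauto.
  - assert (E : forall x, sat G (upd G e n x) p <-> sat G (upd G e' n x) p).
    { intros x. apply IHp. intros k Hk. unfold upd. destruct (Nat.eqb_spec k n); auto. }
    split; intros Hx x; apply E, Hx.
  - assert (E : forall x, sat G (upd G e n x) p <-> sat G (upd G e' n x) p).
    { intros x. apply IHp. intros k Hk. unfold upd. destruct (Nat.eqb_spec k n); auto. }
    split; intros (x & Hx); exists x; apply E, Hx.
Qed.

Lemma sat_sentence (G : group) (p : formula) (e : nat -> G) :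
  sentence p -> (sat G e p <-> models G p).
Proof.
  intros H. split; [|auto]. intros He e'. revert He. apply sat_agree.
  intros k Hk. destruct (H k Hk).
Qed.

Lemma free_in_bounded (p : formula) : exists n, forall k, free_in k p -> k < n.
Proof.
  assert (T : forall t, exists n, forall k, tocc k t -> k < n).
  { induction t as [i| |t (a & Ha) u (b & Hb)|t (a & Ha)]; simpl.
    - exists (S i). lia.
    - exists 0. tauto.
    - exists (a + b). intros k [H|H]; [apply Ha in H|apply Hb in H]; lia.
    - exists a. exact Ha. }
  induction p as [|t u|p (a & Ha)|p (a & Ha) q (b & Hb)|p (a & Ha) q (b & Hb)
                 |p (a & Ha) q (b & Hb)|i p (a & Ha)|i p (a & Ha)]; simpl.
  - exists 0. tauto.
  - destruct (T t) as (a & Ha), (T u) as (b & Hb). exists (a + b).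
    intros k [H|H]; [apply Ha in H|apply Hb in H]; lia.
  - exists a. exact Ha.
  - exists (a + b). intros k [H|H]; [apply Ha in H|apply Hb in H]; lia.
  - exists (a + b). intros k [H|H]; [apply Ha in H|apply Hb in H]; lia.
  - exists (a + b). intros k [H|H]; [apply Ha in H|apply Hb in H]; lia.
  - exists a. intros k [_ H]. auto.
  - exists a. intros k [_ H]. auto.
Qed.

Fixpoint close (n : nat) (p : formula) : formula :=
  match n with O => p | S n => close n (FForall n p) end.

Lemma models_close (G : group) (n : nat) (p : formula) : models G (close n p) <-> models G p.
Proof.
  revert p. induction n as [|n IH]; intros p; simpl; [tauto|].
  rewrite IH. split; intros H e.
  - specialize (H e (e n)). simpl in H.
    replace (upd G e n (e n)) with e in H; [exact H|].
    apply functional_extensionality. intros k. unfold upd.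
    destruct (Nat.eqb_spec k n); congruence.
  - intros x. apply H.
Qed.

Lemma close_free_in (n k : nat) (p : formula) : free_in k (close n p) -> n <= k /\ free_in k p.
Proof.
  revert p. induction n as [|n IH]; intros p H; simpl in *; [split; [lia|exact H]|].
  apply IH in H. simpl in H. destruct H as (H1 & H2 & H3). split; [lia|exact H3].
Qed.

(** Formulas with free variables are included: [models] quantifies over all assignments, so a
    formula and its universal closure have the same models. *)
Lemma elem_equiv_models (G H : group) (p : formula) :
  elem_equiv G H -> (models G p <-> models H p).
Proof.
  intros E. destruct (free_in_bounded p) as (n & Hn).
  rewrite <- (models_close G n), <- (models_close H n). apply E.
  intros k Hk. apply close_free_in in Hk. destruct Hk as (H1 & H2). apply Hn in H2. lia.
Qed.

Lemma elem_equiv_witness (G H : group) (p : formula) :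
  elem_equiv G H -> (exists e, sat G e p) -> exists e, sat H e p.
Proof.
  intros E (e & He). apply NNPP. intros Hn.
  assert (M : models G (FNot p)).
  { apply (elem_equiv_models G H _ E). intros e' He'. apply Hn. eauto. }
  exact (M e He).
Qed.

Lemma not_elem_equiv (G H : group) : ~ elem_equiv G H ->
  exists p, sentence p /\ models G p /\ ~ models H p.
Proof.
  intros N. apply NNPP. intros C. apply N.
  assert (D : forall p, sentence p -> models G p -> models H p).
  { intros p Hp HG. apply NNPP. intros HH. apply C. eauto. }
  intros p Hp. split; [auto|]. intros HH. apply NNPP. intros HG.
  assert (M : models H (FNot p)).
  { apply D; [exact Hp|]. intros e He. apply HG. apply (sat_sentence G p e Hp), He. }
  exact (M (fun _ => gone) (HH _)).
Qed.

Fixpoint fall (l : list formula) : formula :=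
  match l with [] => FNot FFalse | p :: l => FAnd p (fall l) end.

Fixpoint fany (l : list formula) : formula :=
  match l with [] => FFalse | p :: l => FOr p (fany l) end.

Lemma sat_fall {I : Type} (G : group) (e : nat -> G) (F : I -> formula) (l : list I) :
  sat G e (fall (map F l)) <-> forall i, In i l -> sat G e (F i).
Proof.
  induction l as [|i l IH]; simpl; [tauto|]. rewrite IH. split.
  - intros [H1 H2] j [<-|Hj]; auto.
  - intros H. split; auto.
Qed.

Lemma sat_fany {I : Type} (G : group) (e : nat -> G) (F : I -> formula) (l : list I) :
  sat G e (fany (map F l)) <-> exists i, In i l /\ sat G e (F i).
Proof.
  induction l as [|i l IH]; simpl.
  - split; [tauto|]. intros (i & [] & _).
  - rewrite IH. split.
    + intros [H|(j & Hj & H)]; eauto.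
    + intros (j & [<-|Hj] & H); eauto.
Qed.

Definition cen (G : group) (e : nat -> G) (vs : list nat) (x : G) : Prop :=
  forall v, In v vs -> x * e v = e v * x.

Definition fcen (t : term) (vs : list nat) : formula :=
  fall (map (fun v => FEq (Mul t (Var v)) (Mul (Var v) t)) vs).

Lemma sat_fcen (G : group) (e : nat -> G) (t : term) (vs : list nat) :
  sat G e (fcen t vs) <-> cen G e vs (teval G e t).
Proof. unfold fcen. rewrite sat_fall. reflexivity. Qed.

Lemma cen_agree (G : group) (e e' : nat -> G) (vs : list nat) :
  (forall v, In v vs -> e v = e' v) -> cen G e vs = cen G e' vs.
Proof.
  intros H. apply functional_extensionality. intros x. apply propositional_extensionality.
  unfold cen. split; intros K v Hv; [rewrite <- H by exact Hv|rewrite H by exact Hv]; auto.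
Qed.

Lemma cen_subgroup (G : group) (e : nat -> G) (vs : list nat) : subgroup G (cen G e vs).
Proof.
  split; [|split]; unfold cen.
  - intros v _. grp.
  - intros x y Hx Hy v Hv. apply comm_mul; auto.
  - intros x Hx v Hv. apply comm_inv; auto.
Qed.

(* [trans q E p] expresses [p] in the quotient by the congruence defined by [E]; the variables
   of [p] are shifted by [q] to make room for the parameters of [E]. *)
Fixpoint tshift (q : nat) (t : term) : term :=
  match t with
  | Var n => Var (q + n) | One => One
  | Mul t u => Mul (tshift q t) (tshift q u) | Inv t => Inv (tshift q t)
  end.

Fixpoint trans (q : nat) (E : term -> term -> formula) (p : formula) : formula :=
  match p with
  | FFalse => FFalse
  | FEq t u => E (tshift q t) (tshift q u)
  | FNot p => FNot (trans q E p)
  | FAnd p r => FAnd (trans q E p) (trans q E r)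
  | FOr p r => FOr (trans q E p) (trans q E r)
  | FImp p r => FImp (trans q E p) (trans q E r)
  | FForall n p => FForall (q + n) (trans q E p)
  | FExists n p => FExists (q + n) (trans q E p)
  end.

Lemma sat_trans (G Q : group) (f : G -> Q) (q : nat) (e0 : nat -> G)
  (E : term -> term -> formula) :
  is_hom G Q f -> (forall y, exists x, f x = y) ->
  (forall e t u, (forall i, i < q -> e i = e0 i) ->
     (sat G e (E t u) <-> f (teval G e t) = f (teval G e u))) ->
  forall p e, (forall i, i < q -> e i = e0 i) ->
    (sat G e (trans q E p) <-> sat Q (fun n => f (e (q + n))) p).
Proof.
  intros Hf Sur HE.
  assert (T : forall e t, f (teval G e (tshift q t)) = teval Q (fun n => f (e (q + n))) t).
  { intros e. induction t as [n| |t IHt u IHu|t IHt]; simpl.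
    - reflexivity.
    - apply hom_one, Hf.
    - rewrite Hf, IHt, IHu. reflexivity.
    - rewrite (hom_inv _ _ _ _ Hf), IHt. reflexivity. }
  assert (U : forall e n x,
    (fun k => f (upd G e (q + n) x (q + k))) = upd Q (fun k => f (e (q + k))) n (f x)).
  { intros e n x. apply functional_extensionality. intros k. unfold upd.
    destruct (Nat.eqb_spec (q + k) (q + n)), (Nat.eqb_spec k n); auto; lia. }
  assert (A : forall e n x, (forall i, i < q -> e i = e0 i) ->
    forall i, i < q -> upd G e (q + n) x i = e0 i).
  { intros e n x He i Hi. rewrite upd_ne by lia. auto. }
  induction p as [|t u|p IHp|p IHp r IHr|p IHp r IHr|p IHp r IHr|n p IHp|n p IHp];
    simpl; intros e He.
  - tauto.
  - rewrite HE by exact He. rewrite !T. reflexivity.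
  - rewrite IHp by exact He. tauto.
  - rewrite IHp, IHr by exact He. tauto.
  - rewrite IHp, IHr by exact He. tauto.
  - rewrite IHp, IHr by exact He. tauto.
  - split.
    + intros H y. destruct (Sur y) as (x & <-). rewrite <- U. apply IHp; auto.
    + intros H x. apply IHp; [auto|]. rewrite U. apply H.
  - split.
    + intros (x & H). exists (f x). rewrite <- U. apply IHp; auto.
    + intros (y & H). destruct (Sur y) as (x & <-). exists x. apply IHp; [auto|].
      rewrite U. exact H.
Qed.

Lemma sat_trans_sentence (G Q : group) (f : G -> Q) (q : nat) (e : nat -> G)
  (E : term -> term -> formula) (p : formula) :
  is_hom G Q f -> (forall y, exists x, f x = y) ->
  (forall e' t u, (forall i, i < q -> e' i = e i) ->
     (sat G e' (E t u) <-> f (teval G e' t) = f (teval G e' u))) ->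
  sentence p -> (sat G e (trans q E p) <-> models Q p).
Proof.
  intros Hf Sur HE Hp. rewrite (sat_trans G Q f q e E Hf Sur HE p e) by auto.
  apply sat_sentence, Hp.
Qed.

(** * Elementary equivalence and direct factors *)

(** The parameters fill the [l + l] variables from [o] on, and the bound variables are the next
    three. When several blocks are laid side by side, the bound variables only shadow parameters of
    later blocks, which this formula does not mention. *)
Definition ffac (l o : nat) : formula :=
  let ys := seq o l in let zs := seq (o + l) l in
  let a := o + l + l in let b := S a in let c := S b in
  FAnd (FForall a (FForall b (FImp (FAnd (fcen (Var a) ys) (fcen (Var b) zs))
                                (FEq (Mul (Var a) (Var b)) (Mul (Var b) (Var a))))))
  (FAnd (FForall a (FImp (FAnd (fcen (Var a) ys) (fcen (Var a) zs)) (FEq (Var a) One)))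
  (FForall a (FExists b (FExists c
     (FAnd (fcen (Var b) ys) (FAnd (fcen (Var c) zs)
        (FEq (Var a) (Mul (Var b) (Var c))))))))).

Lemma sat_ffac (G : group) (e : nat -> G) (l o : nat) :
  sat G e (ffac l o) <-> fac G (cen G e (seq o l)) (cen G e (seq (o + l) l)).
Proof.
  unfold ffac. cbn [sat].
  set (a := o + l + l).
  assert (U1 : forall e' x, cen G (upd G e' a x) (seq o l) = cen G e' (seq o l)
                      /\ cen G (upd G e' a x) (seq (o + l) l) = cen G e' (seq (o + l) l)).
  { intros e' x. split; apply cen_agree; intros v Hv; apply in_seq in Hv; apply upd_ne; lia. }
  assert (U2 : forall e' x, cen G (upd G e' (S a) x) (seq o l) = cen G e' (seq o l)
                      /\ cen G (upd G e' (S a) x) (seq (o + l) l) = cen G e' (seq (o + l) l)).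
  { intros e' x. split; apply cen_agree; intros v Hv; apply in_seq in Hv; apply upd_ne; lia. }
  assert (U3 : forall e' x, cen G (upd G e' (S (S a)) x) (seq o l) = cen G e' (seq o l)
                      /\ cen G (upd G e' (S (S a)) x) (seq (o + l) l) = cen G e' (seq (o + l) l)).
  { intros e' x. split; apply cen_agree; intros v Hv; apply in_seq in Hv; apply upd_ne; lia. }
  pose proof (fun e' x => proj1 (U1 e' x)) as U1y. pose proof (fun e' x => proj2 (U1 e' x)) as U1z.
  pose proof (fun e' x => proj1 (U2 e' x)) as U2y. pose proof (fun e' x => proj2 (U2 e' x)) as U2z.
  pose proof (fun e' x => proj1 (U3 e' x)) as U3y. pose proof (fun e' x => proj2 (U3 e' x)) as U3z.
  split.
  - intros (H1 & H2 & H3). split; [apply cen_subgroup|split; [apply cen_subgroup|split; [|split]]].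
    + intros x y Hx Hy. specialize (H1 x y). rewrite !sat_fcen in H1. cbn [teval] in H1.
      rewrite U2y, U1y, U2z, U1z, upd_eq, upd_ne, upd_eq in H1 by lia. auto.
    + intros x Hx Hy. specialize (H2 x). rewrite !sat_fcen in H2. cbn [teval] in H2.
      rewrite U1y, U1z, upd_eq in H2. auto.
    + intros g. destruct (H3 g) as (x & y & Hx & Hy & E). exists x, y.
      rewrite sat_fcen in Hx, Hy. cbn [teval] in Hx, Hy, E.
      rewrite U3y, U2y, U1y, upd_ne, upd_eq in Hx by lia.
      rewrite U3z, U2z, U1z, upd_eq in Hy by lia.
      rewrite upd_eq, !(upd_ne G _ (S (S a))), upd_eq, upd_ne, upd_eq in E by lia. auto.
  - intros (_ & _ & H1 & H2 & H3). split; [|split].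
    + intros x y. rewrite !sat_fcen. cbn [teval].
      rewrite U2y, U1y, U2z, U1z, upd_eq, upd_ne, upd_eq by lia. intros []. auto.
    + intros x. rewrite !sat_fcen. cbn [teval]. rewrite U1y, U1z, upd_eq. intros []. auto.
    + intros g. destruct (H3 g) as (x & y & Hx & Hy & E). exists x, y.
      rewrite !sat_fcen. cbn [teval].
      rewrite U3y, U2y, U1y, U3z, U2z, U1z.
      rewrite upd_eq, !(upd_ne G _ (S (S a))), upd_eq, upd_ne, upd_eq by lia. auto.
Qed.

Lemma cen_shift (G : group) (e e' : nat -> G) (o o' l : nat) :
  (forall k, k < l -> e (o + k) = e' (o' + k)) -> cen G e (seq o l) = cen G e' (seq o' l).
Proof.
  intros H. apply functional_extensionality. intros x. apply propositional_extensionality.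
  unfold cen. split; intros K v Hv; apply in_seq in Hv.
  - replace v with (o' + (v - o')) by lia. rewrite <- H by lia. apply K, in_seq. lia.
  - replace v with (o + (v - o)) by lia. rewrite H by lia. apply K, in_seq. lia.
Qed.

Definition same_cen (a : nat) (vs vs' : list nat) : formula :=
  FForall a (FAnd (FImp (fcen (Var a) vs) (fcen (Var a) vs'))
                  (FImp (fcen (Var a) vs') (fcen (Var a) vs))).

Lemma sat_same_cen (G : group) (e : nat -> G) (a : nat) (vs vs' : list nat) :
  (forall v, In v vs -> v < a) -> (forall v, In v vs' -> v < a) ->
  (sat G e (same_cen a vs vs') <-> cen G e vs = cen G e vs').
Proof.
  intros H H'. unfold same_cen. cbn [sat].
  assert (U : forall x, cen G (upd G e a x) vs = cen G e vs).
  { intros x. apply cen_agree. intros v Hv. apply upd_ne. apply H in Hv. lia. }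
  assert (U' : forall x, cen G (upd G e a x) vs' = cen G e vs').
  { intros x. apply cen_agree. intros v Hv. apply upd_ne. apply H' in Hv. lia. }
  split.
  - intros K. apply functional_extensionality. intros x. apply propositional_extensionality.
    specialize (K x). rewrite !sat_fcen, U, U' in K. cbn [teval] in K.
    rewrite upd_eq in K. split; apply K.
  - intros E x. rewrite !sat_fcen, U, U', E. tauto.
Qed.

(** The length [l] is fixed because one sentence can quantify only over tuples of one length. *)
Definition definable_pair (G : group) (l : nat) (p : (G -> Prop) * (G -> Prop)) : Prop :=
  exists e, fac G (fst p) (snd p) /\ p = (cen G e (seq 0 l), cen G e (seq l l)).

Local Close Scope grp_scope.

(** With [q] the pigeonhole bound for all decompositions of [W], the formula [chi] says that if
    [q + 1] parameter blocks all define decompositions, two of these coincide. It holds in [W],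
    hence in [G]. *)
Lemma finite_definable_pairs (W G : group) (l : nat) : elem_equiv W G ->
  finite (fun p : (W -> Prop) * (W -> Prop) => fac W (fst p) (snd p)) ->
  0 < l -> finite (definable_pair G l).
Proof.
  intros HE HF Hl. destruct (finite_pigeonhole _ HF) as (q & Hq).
  (* [d] is the size of a parameter block, and [a] is the first variable beyond the [q + 1]
     blocks. *)
  set (d := l + l). set (a := S q * d).
  set (pairs := filter (fun ij => fst ij <? snd ij) (list_prod (seq 0 (S q)) (seq 0 (S q)))).
  set (chi := FImp (fall (map (fun i => ffac l (i * d)) (seq 0 (S q))))
    (fany (map (fun ij => FAnd (same_cen a (seq (fst ij * d) l) (seq (snd ij * d) l))
                 (same_cen a (seq (fst ij * d + l) l) (seq (snd ij * d + l) l))) pairs))).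
  assert (Pairs : forall i j, In (i, j) pairs <-> i < j /\ j <= q).
  { intros i j. unfold pairs. rewrite filter_In, in_prod_iff, !in_seq. simpl.
    rewrite Nat.ltb_lt. lia. }
  assert (Sem : forall (H : group) (e : nat -> H), sat H e chi <->
    ((forall i, i <= q -> fac H (cen H e (seq (i * d) l)) (cen H e (seq (i * d + l) l))) ->
     exists i j, i < j /\ j <= q /\
       (cen H e (seq (i * d) l), cen H e (seq (i * d + l) l))
       = (cen H e (seq (j * d) l), cen H e (seq (j * d + l) l)))).
  { intros H e. unfold chi. cbn [sat]. rewrite sat_fall, sat_fany.
    assert (B : forall i v, i <= q -> In v (seq (i * d) l) \/ In v (seq (i * d + l) l) -> v < a).
    { intros i v Hi [Hv|Hv]; apply in_seq in Hv; unfold a, d in *; nia. }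
    split; intros K L.
    - destruct K as ((i & j) & Hij & S1 & S2).
      + intros i Hi. apply in_seq in Hi. apply sat_ffac, L. lia.
      + apply Pairs in Hij. cbn [fst snd] in S1, S2.
        rewrite sat_same_cen in S1 by
            (intros v Hv; first [apply (B i v); [lia|tauto] | apply (B j v); [lia|tauto]]).
        rewrite sat_same_cen in S2 by
            (intros v Hv; first [apply (B i v); [lia|tauto] | apply (B j v); [lia|tauto]]).
        exists i, j. rewrite S1, S2. tauto.
    - destruct K as (i & j & Hij & Hj & E).
      + intros i Hi. apply sat_ffac, L, in_seq. lia.
      + exists (i, j). split; [apply Pairs; lia|]. cbn [fst snd sat]. injection E as E1 E2.
        rewrite !sat_same_cen by
            (intros v Hv; first [apply (B i v); [lia|tauto] | apply (B j v); [lia|tauto]]). auto. }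
  assert (MG : models G chi).
  { apply (elem_equiv_models W G chi HE). intros e. apply Sem. intros K.
    apply (Hq (fun i => (cen W e (seq (i * d) l), cen W e (seq (i * d + l) l)))). exact K. }
  apply (pigeonhole_finite _ q). intros f Hf.
  destruct (choice (fun i e => i <= q -> fac G (fst (f i)) (snd (f i)) /\
                       f i = (cen G e (seq 0 l), cen G e (seq l l)))) as (es & Hes).
  { intros i. destruct (le_lt_dec i q) as [Hi|Hi].
    - destruct (Hf i Hi) as (e & He). exists e. auto.
    - exists (fun _ => gone). lia. }
  (* One assignment carries the parameters of all decompositions, those of [f i] in block [i]. *)
  set (e := fun n => es (n / d) (n mod d)).
  assert (Ee : forall i k, k < d -> e (i * d + k) = es i k).
  { intros i k Hk. unfold e. f_equal.
    - rewrite Nat.div_add_l by (unfold d; lia). rewrite Nat.div_small by exact Hk. lia.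
    - rewrite Nat.add_comm, Nat.Div0.mod_add, Nat.mod_small by exact Hk. reflexivity. }
  assert (Ef : forall i, i <= q -> f i = (cen G e (seq (i * d) l), cen G e (seq (i * d + l) l))).
  { intros i Hi. destruct (Hes i Hi) as (_ & ->). f_equal; apply cen_shift; intros k Hk.
    - simpl. symmetry. apply Ee. unfold d. lia.
    - rewrite <- Nat.add_assoc. symmetry. apply Ee. unfold d. lia. }
  destruct (proj1 (Sem G e) (MG e)) as (i & j & Hij & Hj & E).
  - intros i Hi. destruct (Hes i Hi) as (Hfac & _). rewrite (Ef i Hi) in Hfac. exact Hfac.
  - exists i, j. rewrite !Ef by lia. auto.
Qed.

Local Open Scope grp_scope.

(** The elements [q y] generate [N], so the right-hand side describes the centralizer of [N]. The
    [N]-component of such an [x] is central in [W], hence trivial. *)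
Lemma cen_generators (W : group) (M N : W -> Prop) (q : W -> W) (lw : list W) :
  centerless W -> fac W M N -> is_hom W W q -> (forall g, N (q g)) -> (forall y, N y -> q y = y) ->
  generates W (fun x => In x lw) ->
  forall x, M x <-> forall y, In y lw -> x * q y = q y * x.
Proof.
  intros HZ (HM & HN & Hc & Hi & Hs) Hq HqN Hid Hg x. split; [auto|]. intros Hx.
  assert (Hall : forall w, x * q w = q w * x).
  { apply (generates_sub W _ (fun w => x * q w = q w * x) Hg); [|exact Hx].
    split; [rewrite (hom_one _ _ _ Hq); grp|split].
    - intros u v Hu Hv. rewrite Hq. symmetry. apply comm_mul; auto.
    - intros u Hu. rewrite (hom_inv _ _ _ _ Hq). symmetry. apply comm_inv; auto. }
  destruct (Hs x) as (a & b & Ha & Hb & E).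
  assert (Eb : b = gone).
  { apply HZ. intros w. destruct (Hs w) as (u & v & Hu & Hv & ->).
    assert (b * v = v * b).
    { replace b with (a^-1 * x) by (rewrite E; grp).
      apply comm_mul; [apply comm_inv; auto|]. rewrite <- (Hid v Hv). auto. }
    symmetry. apply comm_mul; [auto|]. symmetry. auto. }
  rewrite E, Eb, gmul1r. exact Ha.
Qed.

Definition cong_cen (vs : list nat) (t u : term) : formula := fcen (Mul (Inv u) t) vs.

Lemma sat_trans_factor (G : group) (M N : G -> Prop) (HM : subgroup G M)
  (e : nat -> G) (q : nat) (vs : list nat) (p : formula) :
  fac G M N -> N = cen G e vs -> (forall v, In v vs -> v < q) -> sentence p ->
  (sat G e (trans q (cong_cen vs) p) <-> models (sub G M HM) p).
Proof.
  intros F EN Hvs Hp. destruct (fac_proj_surj G M N HM F) as (f & Hf & Sf & Kf).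
  apply (sat_trans_sentence G _ f); auto.
  intros e' t u He'. unfold cong_cen. rewrite sat_fcen, Kf, EN. cbn [teval].
  rewrite (cen_agree G e' e) by auto. reflexivity.
Qed.

(** If each of the finitely many definable decompositions of [G] failed, the sentences refuting them
    could be collected into one [th] for the first factor and one [ph] for the second. The existence
    of parameters whose two quotients satisfy [th] and [ph] passes from [W] to [G] and contradicts
    this. *)
Lemma elem_equiv_factors (W G : group) (M N : W -> Prop)
  (HM : subgroup W M) (HN : subgroup W N) :
  centerless W -> finitely_generated W ->
  finite (fun p : (W -> Prop) * (W -> Prop) => fac W (fst p) (snd p)) ->
  fac W M N -> elem_equiv W G ->
  exists (M' N' : G -> Prop) (HM' : subgroup G M') (HN' : subgroup G N'),
    fac G M' N' /\ elem_equiv (sub W M HM) (sub G M' HM') /\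
    elem_equiv (sub W N HN) (sub G N' HN').
Proof.
  intros HZ (lw & Hlw) HF F HE.
  destruct (fac_proj W M N F) as (p & q & Hp & Hq & HpM & HqN & Epq & U).
  set (l := S (length lw)).
  (* The first block holds the [N]-components of the generators because their centralizer is [M];
     the second is the reverse. The extra slot of each block, which keeps [l] positive, holds [gone]
     and imposes no condition. *)
  set (e := fun n => if n <? l then nth n (map q lw) gone else nth (n - l) (map p lw) gone).
  assert (E0 : forall k, k < l -> e k = nth k (map q lw) gone).
  { intros k Hk. unfold e. apply Nat.ltb_lt in Hk. rewrite Hk. reflexivity. }
  assert (E1 : forall k, e (l + k) = nth k (map p lw) gone).
  { intros k. unfold e. destruct (Nat.ltb_spec (l + k) l); [lia|]. f_equal. lia. }
  assert (Cen : forall (f : W -> W) x o,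
    (forall k, k < l -> e (o + k) = nth k (map f lw) gone) ->
    (cen W e (seq o l) x <-> forall y, In y lw -> x * f y = f y * x)).
  { intros f x o Hf. split.
    - intros H y Hy. apply (In_nth _ _ gone) in Hy. destruct Hy as (k & Hk & <-).
      assert (Ek : f (nth k lw gone) = e (o + k)).
      { rewrite Hf by (unfold l; lia). rewrite <- (map_nth f lw gone k).
        apply nth_indep. rewrite length_map. exact Hk. }
      rewrite Ek. apply H, in_seq. unfold l. lia.
    - intros H v Hv. apply in_seq in Hv. replace v with (o + (v - o)) by lia.
      rewrite Hf by lia. destruct (nth_in_or_default (v - o) (map f lw) gone) as [Hin|Hd].
      + apply in_map_iff in Hin. destruct Hin as (y & <- & Hy). auto.
      + rewrite Hd. grp. }
  assert (EM : M = cen W e (seq 0 l)).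
  { apply functional_extensionality. intros x. apply propositional_extensionality.
    rewrite (Cen q) by exact E0. apply (cen_generators W M N q lw); auto.
    intros y Hy. destruct (U gone y) as [_ U2]; [apply sub_one, HM|exact Hy|].
    rewrite gmul1l in U2. exact U2. }
  assert (EN : N = cen W e (seq l l)).
  { apply functional_extensionality. intros x. apply propositional_extensionality.
    rewrite (Cen p) by auto. apply (cen_generators W N M p lw); auto using fac_sym.
    intros y Hy. destruct (U y gone) as [U1 _]; [exact Hy|apply sub_one, HN|].
    rewrite gmul1r in U1. exact U1. }
  destruct (finite_definable_pairs W G l HE HF) as (lp & Hlp); [unfold l; lia|].
  apply NNPP. intros Hno.
  assert (ST : sentence (FNot FFalse)) by (intros k; simpl; tauto).
  assert (MT : forall H, models H (FNot FFalse)) by (intros H e'; simpl; tauto).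
  assert (Bad : forall lp : list ((G -> Prop) * (G -> Prop)),
    exists th ph, sentence th /\ sentence ph /\
      models (sub W M HM) th /\ models (sub W N HN) ph /\
      forall P, In P lp -> fac G (fst P) (snd P) ->
        forall (HM' : subgroup G (fst P)) (HN' : subgroup G (snd P)),
        ~ (models (sub G _ HM') th /\ models (sub G _ HN') ph)).
  { clear lp Hlp. induction lp as [|P lp (th & ph & S1 & S2 & M1 & M2 & H)].
    - exists (FNot FFalse), (FNot FFalse). do 4 (split; [auto|]). intros P [].
    - destruct (classic (fac G (fst P) (snd P))) as [FP|FP].
      2: { exists th, ph. do 4 (split; [assumption|]).
           intros P' [<-|HP'] FP'; [contradiction|apply H; assumption]. }
      assert (HMP : subgroup G (fst P)) by apply FP.
      assert (HNP : subgroup G (snd P)) by (destruct FP as (_ & HNP & _); exact HNP).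
      assert (B : exists th' ph', sentence th' /\ sentence ph' /\
        models (sub W M HM) th' /\ models (sub W N HN) ph' /\
        ~ (models (sub G _ HMP) th' /\ models (sub G _ HNP) ph')).
      { destruct (classic (elem_equiv (sub W M HM) (sub G _ HMP))) as [EqM|EqM].
        - destruct (classic (elem_equiv (sub W N HN) (sub G _ HNP))) as [EqN|EqN].
          + exfalso. apply Hno. eauto 10.
          + destruct (not_elem_equiv _ _ EqN) as (ph' & S3 & M3 & M4).
            exists (FNot FFalse), ph'. do 4 (split; [auto|]). tauto.
        - destruct (not_elem_equiv _ _ EqM) as (th' & S3 & M3 & M4).
          exists th', (FNot FFalse). do 4 (split; [auto|]). tauto. }
      destruct B as (th' & ph' & S3 & S4 & M3 & M4 & H').
      exists (FAnd th' th), (FAnd ph' ph).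
      split; [|split; [|split; [|split]]].
      + intros k [Hk|Hk]; [apply (S3 k)|apply (S1 k)]; exact Hk.
      + intros k [Hk|Hk]; [apply (S4 k)|apply (S2 k)]; exact Hk.
      + intros e'. split; auto.
      + intros e'. split; auto.
      + intros P' [<-|HP'] FP' HM' HN' [K1 K2].
        * rewrite (proof_irrelevance _ HM' HMP), (proof_irrelevance _ HN' HNP) in *.
          apply H'. split; intros e'; [apply (K1 e')|apply (K2 e')].
        * apply (H P' HP' FP' HM' HN'). split; intros e'; [apply (K1 e')|apply (K2 e')]. }
  destruct (Bad lp) as (th & ph & S1 & S2 & M1 & M2 & H).
  assert (Lt : forall v, In v (seq 0 l) \/ In v (seq l l) -> v < l + l).
  { intros v [Hv|Hv]; apply in_seq in Hv; lia. }
  destruct (elem_equiv_witness W G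
    (FAnd (ffac l 0) (FAnd (trans (l + l) (cong_cen (seq l l)) th)
                           (trans (l + l) (cong_cen (seq 0 l)) ph))) HE) as (e' & G1 & G2 & G3).
  { exists e. split; [|split].
    - apply sat_ffac. change (0 + l) with l. rewrite <- EM, <- EN. exact F.
    - apply (sat_trans_factor W M N HM); auto.
    - apply (sat_trans_factor W N M HN); auto using fac_sym. }
  apply sat_ffac in G1. change (0 + l) with l in G1.
  pose proof (cen_subgroup G e' (seq 0 l)) as HM'.
  pose proof (cen_subgroup G e' (seq l l)) as HN'.
  apply (H (cen G e' (seq 0 l), cen G e' (seq l l))) with (HM' := HM') (HN' := HN').
  - apply Hlp. exists e'. auto.
  - exact G1.
  - split.
    + apply (sat_trans_factor G _ (cen G e' (seq l l)) HM' e' (l + l) (seq l l)); auto.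
    + apply (sat_trans_factor G _ (cen G e' (seq 0 l)) HN' e' (l + l) (seq 0 l)); auto using fac_sym.
Qed.

(** * Splitting off the finite factor *)

(* [u^-1 r u = r (r^-1 u^-1)^2 (u r u^-1)^2 u^2] *)
Lemma square_conj (G : group) (C R : G -> Prop) (u r : G) :
  subgroup G C -> subgroup G R -> (forall x, R x -> C x) -> (forall x, C x -> R (x * x)) ->
  C u -> R r -> R (u^-1 * r * u).
Proof.
  intros HC HR RC Sq Hu Hr.
  replace (u^-1 * r * u) with
    (r * (((r^-1 * u^-1) * (r^-1 * u^-1)) * (((u * r * u^-1) * (u * r * u^-1)) * (u * u)))) by grp.
  pose proof (sub_inv G C u HC Hu). pose proof (sub_inv G C r HC (RC r Hr)).
  assert (C r) by auto.
  do 3 (apply (sub_mul G R); [exact HR|auto; apply Sq; repeat (apply (sub_mul G C); auto)|]).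
  apply Sq, Hu.
Qed.

(** Since [R] contains the squares of [C], it is normalized by [u] and contains [u * u]; hence [R]
    and its coset of [u] form a subgroup. *)
Lemma adjoin_subgroup (G : group) (C R : G -> Prop) (u : G) :
  subgroup G C -> subgroup G R -> (forall x, R x -> C x) -> (forall x, C x -> R (x * x)) ->
  C u -> subgroup G (fun x => R x \/ exists r, R r /\ x = u * r).
Proof.
  intros HC HR RC Sq Hu.
  pose proof (fun r => square_conj G C R u r HC HR RC Sq Hu) as Cj.
  pose proof (sub_inv G C u HC Hu) as Hu'.
  split; [left; apply sub_one, HR|split].
  - intros x y [Hx|(r & Hr & ->)] [Hy|(r' & Hr' & ->)].
    + left. apply sub_mul; auto.
    + right. exists (u^-1 * x * u * r'). split; [apply sub_mul; auto|grp].
    + right. exists (r * y). split; [apply sub_mul; auto|grp].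
    + left. replace (u * r * (u * r')) with ((u * u) * ((u^-1 * r * u) * r')) by grp.
      apply sub_mul; [exact HR|auto|]. apply sub_mul; auto.
  - intros x [Hx|(r & Hr & ->)].
    + left. apply sub_inv; auto.
    + right. exists ((u^-1 * r^-1 * u) * (u^-1 * u^-1)). split; [|grp].
      apply sub_mul; auto. apply Cj, sub_inv; auto.
Qed.

(** A greedy choice of complement: [u] is adjoined to [R] unless this creates a nontrivial element
    [u * r] of [F], and in that case [u] already lies in [F * R]. *)
Lemma complement_extend (G : group) (C F : G -> Prop) (l : list G) : subgroup G C ->
  subgroup G F -> (forall u, In u l -> C u) -> forall R : G -> Prop,
  subgroup G R -> (forall x, R x -> C x) -> (forall x, C x -> R (x * x)) ->
  (forall x, F x -> R x -> x = gone) ->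
  exists R' : G -> Prop, subgroup G R' /\ (forall x, R' x -> C x) /\
    (forall x, F x -> R' x -> x = gone) /\ (forall x, R x -> R' x) /\
    forall u, In u l -> exists f r, F f /\ R' r /\ u = f * r.
Proof.
  intros HC HF. induction l as [|u l IH]; intros Hl R HR RC Sq FR.
  - exists R. repeat (split; [auto|]). intros u [].
  - assert (Hu : C u) by (apply Hl; simpl; auto).
    assert (Hl' : forall v, In v l -> C v) by (intros v Hv; apply Hl; simpl; auto).
    destruct (classic (forall x, F x -> (R x \/ exists r, R r /\ x = u * r) -> x = gone)) as [T|T].
    + destruct (IH Hl' (fun x => R x \/ exists r, R r /\ x = u * r))
        as (R' & H1 & H2 & H3 & H4 & H5); auto.
      * apply (adjoin_subgroup G C); auto.
      * intros x [Hx|(r & Hr & ->)]; auto. apply sub_mul; auto.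
      * exists R'. repeat (split; [auto|]). intros v [<-|Hv]; auto.
        exists gone, u. split; [apply sub_one, HF|split; [|grp]].
        apply H4. right. exists gone. split; [apply sub_one, HR|grp].
    + destruct (IH Hl' R) as (R' & H1 & H2 & H3 & H4 & H5); auto.
      exists R'. repeat (split; [auto|]). intros v [<-|Hv]; auto.
      apply NNPP. intros N. apply T. intros x Hx [Hx'|(r & Hr & ->)]; auto.
      exfalso. apply N. exists (u * r), (r^-1). split; [auto|split; [|grp]].
      apply H4, sub_inv; auto.
Qed.

Fixpoint sqp (G : group) (l : list G) : G :=
  match l with [] => gone | x :: l => x * x * sqp G l end.

Fixpoint fsqp (l : list nat) : term :=
  match l with [] => One | v :: l => Mul (Mul (Var v) (Var v)) (fsqp l) end.

Lemma teval_fsqp (G : group) (e : nat -> G) (l : list nat) :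
  teval G e (fsqp l) = sqp G (map e l).
Proof. induction l as [|v l IH]; simpl; congruence. Qed.

Lemma sqp_app (G : group) (l l' : list G) : sqp G (l ++ l') = sqp G l * sqp G l'.
Proof. induction l as [|x l IH]; simpl; [grp|rewrite IH; grp]. Qed.

Lemma sqp_inv (G : group) (l : list G) :
  (sqp G l)^-1 = sqp G (rev (map (fun x => x^-1) l)).
Proof. induction l as [|x l IH]; simpl; [grp|rewrite sqp_app, <- IH; simpl; grp]. Qed.

Lemma sqp_subgroup (G : group) (C : G -> Prop) : subgroup G C ->
  subgroup G (fun x => exists l, (forall u, In u l -> C u) /\ sqp G l = x).
Proof.
  intros HC. split; [exists []; split; [intros u []|reflexivity]|split].
  - intros x y (l & Hl & <-) (l' & Hl' & <-). exists (l ++ l'). rewrite sqp_app.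
    split; [|reflexivity]. intros u Hu. apply in_app_or in Hu. destruct Hu; auto.
  - intros x (l & Hl & <-). exists (rev (map (fun x => x^-1) l)). rewrite sqp_inv.
    split; [|reflexivity]. intros u Hu. apply in_rev, in_map_iff in Hu.
    destruct Hu as (v & <- & Hv). apply sub_inv; auto.
Qed.

Lemma code_env (A : Type) (G : group) (c : A -> nat) (h : A -> G) :
  (forall x y, c x = c y -> x = y) -> exists e, forall x, e (c x) = h x.
Proof.
  intros Hc. destruct (choice (fun n g => forall x, c x = n -> g = h x)) as (e & He).
  - intros n. destruct (classic (exists x, c x = n)) as [(x & Hx)|N].
    + exists (h x). intros y Hy. f_equal. apply Hc. congruence.
    + exists gone. intros x Hx. exfalso. eauto.
  - exists e. intros x. apply He. reflexivity.
Qed.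

(* What a first-order formula retains of the position of the finite factor [A]. *)
Definition normal_embedding (A G : group) (h : A -> G) : Prop :=
  is_hom A G h /\ (forall x y, h x = h y -> x = y) /\
  (forall g x, exists y, g * h x * g^-1 = h y) /\
  (forall g, exists u x, (forall y, u * h y = h y * u) /\ g = h x * u).

(** * Formulas about the position of the finite factor *)

Section FiniteFactor.
Variables (A : group) (lA : list A) (c : A -> nat).
Hypotheses (HlA : forall x, In x lA) (Hc : forall x y, c x = c y -> x = y)
  (Hb : forall x, c x < length lA).

Let q := length lA.

(** The element [x] of [A] is represented by the variable [c x]. Since [A] is finite, its products
    and equalities are decided outside the formula. *)
Definition fembed : formula :=
  FAnd (fall (map (fun x => fall (map (fun y =>
          FEq (Mul (Var (c x)) (Var (c y))) (Var (c (x * y)))) lA)) lA))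
  (FAnd (fall (map (fun x => fall (map (fun y =>
          if excluded_middle_informative (x = y) then FNot FFalse
          else FNot (FEq (Var (c x)) (Var (c y)))) lA)) lA))
  (FAnd (FForall q (fall (map (fun x => fany (map (fun y =>
          FEq (Mul (Mul (Var q) (Var (c x))) (Inv (Var q))) (Var (c y))) lA)) lA)))
  (FForall q (FExists (S q) (FAnd (fcen (Var (S q)) (map c lA))
          (fany (map (fun x => FEq (Var q) (Mul (Var (c x)) (Var (S q)))) lA))))))).

Lemma cen_code (G : group) (e : nat -> G) (u : G) :
  cen G e (map c lA) u <-> forall x, u * e (c x) = e (c x) * u.
Proof.
  unfold cen. split.
  - intros H x. apply H, in_map, HlA.
  - intros H v Hv. apply in_map_iff in Hv. destruct Hv as (x & <- & _). apply H.
Qed.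

Lemma sat_fembed (G : group) (e : nat -> G) :
  sat G e fembed <-> normal_embedding A G (fun x => e (c x)).
Proof.
  assert (Lt : forall x, c x <> q /\ c x <> S q).
  { intros x. specialize (Hb x). unfold q. lia. }
  assert (U : forall n g x, n = q \/ n = S q -> forall e, upd G e n g (c x) = e (c x)).
  { intros n g x Hn e'. apply upd_ne. specialize (Lt x). lia. }
  assert (Ne : q <> S q) by lia.
  unfold fembed, normal_embedding. cbn [sat]. rewrite !sat_fall.
  split.
  - intros (H1 & H2 & H3 & H4). split; [|split; [|split]].
    + intros x y. specialize (H1 x (HlA x)). rewrite sat_fall in H1.
      symmetry. exact (H1 y (HlA y)).
    + intros x y E. specialize (H2 x (HlA x)). rewrite sat_fall in H2.
      specialize (H2 y (HlA y)). destruct excluded_middle_informative; [auto|].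
      destruct (H2 E).
    + intros g x. specialize (H3 g). rewrite sat_fall in H3. specialize (H3 x (HlA x)).
      rewrite sat_fany in H3. destruct H3 as (y & _ & E). exists y.
      cbn [sat teval] in E. rewrite !upd_eq, !U in E by auto. exact E.
    + intros g. destruct (H4 g) as (u & K1 & K2). rewrite sat_fany in K2.
      destruct K2 as (x & _ & E). exists u, x. split.
      * apply cen_code. apply sat_fcen in K1. cbn [teval] in K1. rewrite upd_eq in K1.
        rewrite cen_code in K1. apply cen_code. intros y. specialize (K1 y).
        rewrite !U in K1 by auto. exact K1.
      * cbn [sat teval] in E. rewrite upd_eq, upd_ne, upd_eq, !U in E by auto. exact E.
  - intros (H1 & H2 & H3 & H4). split; [|split; [|split]].
    + intros x _. apply sat_fall. intros y _. symmetry. apply H1.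
    + intros x _. apply sat_fall. intros y _.
      destruct excluded_middle_informative as [E|N]; simpl; [tauto|]. intros E. apply N. auto.
    + intros g. apply sat_fall. intros x _. apply sat_fany.
      destruct (H3 g x) as (y & E). exists y. split; [apply HlA|].
      cbn [sat teval]. rewrite !upd_eq, !U by auto. exact E.
    + intros g. destruct (H4 g) as (u & x & K1 & K2). exists u. split.
      * apply sat_fcen. cbn [teval]. rewrite upd_eq. apply cen_code. intros y.
        rewrite !U by auto. apply K1.
      * apply sat_fany. exists x. split; [apply HlA|].
        cbn [sat teval]. rewrite upd_eq, upd_ne, upd_eq, !U by auto. exact K2.
Qed.

Definition cong_code (t u : term) : formula :=
  fany (map (fun x => FEq t (Mul u (Var (c x)))) lA).

(** A separate formula for each number [n] of squares, as no bound on that number is available. The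
    squared elements are the variables from [q] on. *)
Definition fsquares (n : nat) : formula :=
  FImp (fall (map (fun v => fcen (Var v) (map c lA)) (seq q n)))
    (fall (map (fun x => FImp (FEq (fsqp (seq q n)) (Var (c x))) (FEq (Var (c x)) One)) lA)).

Lemma sat_fsquares (G : group) (e : nat -> G) (n : nat) :
  sat G e (fsquares n) <->
  ((forall v, In v (seq q n) -> forall x, e v * e (c x) = e (c x) * e v) ->
   forall x, sqp G (map e (seq q n)) = e (c x) -> e (c x) = gone).
Proof.
  unfold fsquares. cbn [sat]. rewrite !sat_fall. cbn [sat]. rewrite teval_fsqp. cbn [teval].
  split.
  - intros H K x. apply H; [|apply HlA]. intros v Hv.
    apply sat_fcen. cbn [teval]. apply cen_code, (K v Hv).
  - intros H K x _. apply H. intros v Hv. apply cen_code.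
    exact (proj1 (sat_fcen G e (Var v) _) (K v Hv)).
Qed.

Lemma sat_trans_code (G : group) (h : A -> G) (F R : G -> Prop) (HR : subgroup G R)
  (e : nat -> G) (p : formula) :
  (forall x, e (c x) = h x) -> (forall g, F g <-> exists x, h x = g) -> fac G R F ->
  sentence p -> (sat G e (trans q cong_code p) <-> models (sub G R HR) p).
Proof.
  intros He HF Fac Hp. destruct (fac_proj_surj G R F HR Fac) as (f & Hf & Sf & Kf).
  apply (sat_trans_sentence G _ f); auto.
  intros e' t u He'. unfold cong_code. rewrite sat_fany, Kf, HF.
  assert (E : forall x, e' (c x) = h x) by (intros x; rewrite He'; auto; apply Hb).
  split.
  - intros (x & _ & Hx). cbn [sat teval] in Hx. exists x. rewrite Hx, E. grp.
  - intros (x & Hx). exists x. split; [apply HlA|]. cbn [sat teval]. rewrite E, Hx. grp.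
Qed.

End FiniteFactor.

(** The projection of the image of [h] to [N] is a finite normal subgroup, hence trivial. So [h]
    maps [F] injectively into [F], and by finiteness onto it. *)
Lemma embedding_unique (W : group) (F N : W -> Prop) (HF : subgroup W F) (HN : subgroup W N)
  (h : sub W F HF -> W) :
  fac W F N -> finite F -> no_finite_normal (sub W N HN) ->
  normal_embedding (sub W F HF) W h -> forall g, F g <-> exists x, h x = g.
Proof.
  intros Fac (lF & HlF) Hno (H1 & H2 & H3 & _).
  destruct (sig_list F lF) as (lA & HlA & _).
  assert (Full : forall x : sub W F HF, In x lA) by (intros x; apply HlA, HlF, proj2_sig).
  destruct (fac_proj_surj W N F HN (fac_sym W _ _ Fac)) as (p & Hp & Sp & Kp).
  assert (HFh : forall x, F (h x)).
  { intros x. assert (E : p (h x) = gone).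
    { apply (Hno (fun y => exists x, p (h x) = y)); [| | |eauto].
      - split; [exists gone; rewrite (hom_one _ _ _ H1); apply hom_one, Hp|split].
        + intros u v (y & <-) (z & <-). exists (y * z). rewrite H1. apply Hp.
        + intros u (y & <-). exists (y^-1). rewrite (hom_inv _ _ _ _ H1). apply hom_inv, Hp.
      - intros g u (y & <-). destruct (Sp g) as (g' & <-).
        destruct (H3 g' y) as (z & E). exists z.
        rewrite <- E, !Hp, (hom_inv _ _ _ _ Hp). reflexivity.
      - exists (map (fun x => p (h x)) lA). intros u (y & <-).
        apply (in_map (fun x => p (h x))), Full. }
    rewrite <- (hom_one _ _ _ Hp) in E. apply Kp in E. rewrite ginv1, gmul1l in E. exact E. }
  intros g. split; [|intros (x & <-); apply HFh].
  intros Hg.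
  assert (Sur : Surjective (fun x => exist F (h x) (HFh x) : sub W F HF)).
  { apply Endo_Injective_Surjective.
    - exists lA. exact Full.
    - intros x y. apply classic.
    - intros x y E. apply H2. apply (f_equal (@proj1_sig _ _)) in E. exact E. }
  destruct (Sur (exist F g Hg)) as (x & Hx). exists x.
  apply (f_equal (@proj1_sig _ _)) in Hx. exact Hx.
Qed.

(** Only the embedding of [F] is transferred by a formula. The complement [R] is chosen inside [G],
    and its theory is read off the quotient of [G] by the image of [F]. *)
Lemma elem_equiv_finite_factor (W G : group) (F N : W -> Prop)
  (HF : subgroup W F) (HN : subgroup W N) :
  fac W F N -> finite F -> no_finite_normal (sub W N HN) ->
  (forall z, F z -> (forall w, z * w = w * z) -> z * z = gone) ->
  elem_equiv W G -> finitely_generated G ->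
  exists (F' R : G -> Prop) (HF' : subgroup G F') (HR : subgroup G R),
    fac G F' R /\
    (exists f : sub W F HF -> sub G F' HF', is_hom _ _ f /\
       (forall x y, f x = f y -> x = y) /\ (forall y, exists x, f x = y)) /\
    elem_equiv (sub W N HN) (sub G R HR).
Proof.
  intros Fac Ffin Hno Hcen HE (lG & HlG).
  set (A := sub W F HF) in *.
  assert (HA : exists lA : list A, forall x : A, In x lA).
  { destruct Ffin as (lF & HlF). destruct (sig_list F lF) as (lA & HlA & _). exists lA.
    intros x. apply HlA, HlF, proj2_sig. }
  destruct HA as (lA & Full).
  destruct (finite_code lA) as (c & Hc0 & Hb0).
  assert (Hc : forall x y : A, c x = c y -> x = y) by (intros; apply Hc0; auto).
  assert (Hb : forall x : A, c x < length lA) by auto. clear Hc0 Hb0.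
  pose proof Fac as (_ & _ & Hcm & Hi & Hs).
  destruct (elem_equiv_witness W G (fembed A lA c) HE) as (e & He).
  { destruct (code_env A W c (fun x => proj1_sig x) Hc) as (e & He). exists e.
    apply sat_fembed; auto.
    refine (eq_ind (fun x : A => proj1_sig x) (normal_embedding A W) _ _
              (eq_sym (functional_extensionality _ _ He))).
    split; [apply sub_val_hom|split; [intros x y; apply sig_eq|split]].
    - intros g [x Hx]. exists (exist F _ (fac_normal W F N Fac g x Hx)). reflexivity.
    - intros g. destruct (Hs g) as (x & y & Hx & Hy & ->).
      exists y, (exist F x Hx). split; [|reflexivity].
      intros [z Hz]. symmetry. apply Hcm; assumption. }
  apply sat_fembed in He; auto.
  set (h := fun x : A => e (c x)) in *. pose proof He as (Hh & Hinj & _ & Hcov).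
  set (F' := fun g => exists x : A, h x = g).
  set (C := fun u => forall x : A, u * h x = h x * u).
  assert (HF' : subgroup G F').
  { split; [exists gone; apply hom_one, Hh|split].
    - intros u v (x & <-) (y & <-). exists (x * y). apply Hh.
    - intros u (x & <-). exists (x^-1). apply hom_inv, Hh. }
  assert (HC : subgroup G C).
  { destruct (centralizer_subgroup G F') as (C1 & C2 & C3). unfold C, F' in *.
    split; [intros x; grp|split].
    - intros u v Hu Hv x. apply comm_mul; auto.
    - intros u Hu x. apply comm_inv; auto. }
  (* In [W] an element centralizing the image [F] is [a * b] with [b] in [N] and [a] in [F], where
     [a] is central in [W] and thus an involution. Its square [b * b] lies in [N], which meets [F]
     trivially. *)
  assert (Sq : forall l x, (forall u, In u l -> C u) -> sqp G l = h x -> h x = gone).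
  { intros l x Hl E.
    assert (M : models W (FImp (fembed A lA c) (fsquares A lA c (length l)))).
    { intros e' Hemb. apply sat_fembed in Hemb; auto. apply sat_fsquares; auto.
      pose proof (embedding_unique W F N HF HN _ Fac Ffin Hno Hemb) as HFe.
      intros Hv y Ey. apply Hi.
      - apply HFe. exists y. reflexivity.
      - rewrite <- Ey. clear Ey.
        induction (seq (length lA) (length l)) as [|v vs IH]; simpl.
        + apply sub_one, HN.
        + apply sub_mul; [exact HN| |apply IH; intros w Hw; apply Hv; simpl; auto].
          destruct (Hs (e' v)) as (a & b & Ha & Hb' & Eab).
          assert (Ca : forall w, a * w = w * a).
          { intros w. destruct (Hs w) as (a' & b' & Ha' & Hb'' & ->).
            assert (E1 : a * a' = a' * a).
            { replace a with (e' v * b^-1) by (rewrite Eab; grp).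
              apply HFe in Ha'. destruct Ha' as (z & <-). apply comm_mul.
              - apply Hv. simpl. auto.
              - apply comm_inv. symmetry. apply Hcm; [apply HFe; eauto|assumption]. }
            symmetry. apply comm_mul; [auto|]. symmetry. auto. }
          replace (e' v * e' v) with (b * b); [apply sub_mul; auto|].
          transitivity (a * a * (b * b)); [rewrite (Hcen a Ha Ca); grp|].
          rewrite Eab, !gmulA'. f_equal. rewrite !gmulA. f_equal. apply Ca. }
    apply (elem_equiv_models W G _ HE) in M.
    set (q := length lA) in *.
    (* The codes of [A] keep their values, and the elements to be squared follow from variable [q]
       on. *)
    set (e' := fun n => if n <? q then e n else nth (n - q) l gone).
    assert (Ee : forall y, e' (c y) = h y).
    { intros y. unfold e', h. specialize (Hb y). fold q in Hb. apply Nat.ltb_lt in Hb.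
      rewrite Hb. reflexivity. }
    assert (El : map e' (seq q (length l)) = l).
    { apply (nth_ext _ _ gone gone); rewrite length_map, length_seq; [reflexivity|].
      intros n Hn. rewrite (nth_indep _ gone (e' 0)) by (rewrite length_map, length_seq; exact Hn).
      rewrite map_nth, seq_nth by exact Hn. unfold e'.
      destruct (Nat.ltb_spec (q + n) q); [lia|]. f_equal. lia. }
    specialize (M e'). cbn [sat] in M. rewrite sat_fembed in M by auto.
    rewrite sat_fsquares in M by auto.
    assert (Eh : (fun y => e' (c y)) = h) by (apply functional_extensionality, Ee).
    rewrite Eh in M. fold q in M. rewrite El in M. rewrite <- (Ee x). apply M; auto.
    - intros v Hv y. rewrite Ee. apply Hl. rewrite <- El. apply in_map, Hv.
    - rewrite Ee. exact E. }
  destruct (choice (fun g u => C u /\ exists x, g = h x * u)) as (cg & Hcg).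
  { intros g. destruct (Hcov g) as (u & x & Hu & E). exists u. split; [exact Hu|eauto]. }
  (* The extension starts from the subgroup of all products of squares of [C], which meets [F']
     trivially by [Sq], and absorbs the centralizing components of the finitely many generators of
     [G]. *)
  destruct (complement_extend G C F' (map cg lG) HC HF') with
    (R := fun x => exists l, (forall u, In u l -> C u) /\ sqp G l = x)
    as (R & HR & RC & FR & _ & Hdec).
  { intros u Hu. apply in_map_iff in Hu. destruct Hu as (g & <- & _). apply Hcg. }
  { apply sqp_subgroup, HC. }
  { intros x (l & Hl & <-). clear - Hl HC. induction l as [|u l IH]; simpl.
    - apply sub_one, HC.
    - assert (Hu : C u) by (apply Hl; simpl; auto).
      assert (Hl' : C (sqp G l)) by (apply IH; intros v Hv; apply Hl; simpl; auto).
      repeat apply sub_mul; auto. }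
  { intros x Hx. exists [x]. split; [intros u [<-|[]]; exact Hx|simpl; grp]. }
  { intros x (y & <-) (l & Hl & E). apply (Sq l); auto. }
  assert (Cm : forall x y, F' x -> R y -> x * y = y * x).
  { intros x y (z & <-) Hy. symmetry. apply RC, Hy. }
  assert (Fac' : fac G F' R).
  { split; [exact HF'|split; [exact HR|split; [exact Cm|split; [exact FR|]]]].
    apply (generates_sub G _ (fun g => exists x y, F' x /\ R y /\ g = x * y) HlG).
    - split; [|split].
      + exists gone, gone. split; [apply sub_one, HF'|split; [apply sub_one, HR|grp]].
      + intros u v (x & y & Hx & Hy & ->) (x' & y' & Hx' & Hy' & ->).
        exists (x * x'), (y * y'). split; [apply sub_mul; auto|split; [apply sub_mul; auto|]].
        rewrite !gmulA'. f_equal. rewrite !gmulA. f_equal. symmetry. auto.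
      + intros u (x & y & Hx & Hy & ->). exists (x^-1), (y^-1).
        split; [apply sub_inv; auto|split; [apply sub_inv; auto|]].
        rewrite Cm by auto. grp.
    - intros g Hg. destruct (Hcg g) as (_ & x & Ex).
      destruct (Hdec (cg g)) as (f & r & Hf & Hr & Er); [apply in_map, Hg|].
      exists (h x * f), r. split; [|split; [exact Hr|]].
      + apply sub_mul; [exact HF'|exists x; reflexivity|exact Hf].
      + rewrite Ex at 1. rewrite Er. grp. }
  exists F', R, HF', HR. split; [exact Fac'|split].
  - exists (fun x => exist F' (h x) (ex_intro _ x eq_refl)). split; [|split].
    + intros x y. apply sig_eq, Hh.
    + intros x y E. apply Hinj. apply (f_equal (@proj1_sig _ _)) in E. exact E.
    + intros [y (x & Hx)]. exists x. apply sig_eq. exact Hx.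
  - apply NNPP. intros Hne. destruct (not_elem_equiv _ _ Hne) as (p & Hp & M1 & M2).
    apply M2. apply (sat_trans_code A lA c Full Hb G h F' R HR e p); auto.
    + intros g. reflexivity.
    + apply fac_sym, Fac'.
    (* In [W] every embedding of this kind has image [F], so the quotient is always [N] and [p]
       holds in it for all parameters. *)
    + assert (M : models W (FImp (fembed A lA c) (trans (length lA) (cong_code A lA c) p))).
      { intros e' Hemb. apply sat_fembed in Hemb; auto.
        apply (sat_trans_code A lA c Full Hb W (fun x => e' (c x)) F N HN e' p); auto.
        - apply (embedding_unique W F N HF HN _ Fac Ffin Hno Hemb).
        - apply fac_sym, Fac. }
      apply (elem_equiv_models W G _ HE) in M. apply M. apply sat_fembed; auto.
Qed.

(** * Reduction to connected diagrams *)

Lemma infinite_part_case :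
  (forall W G : group,
      is_irreducible_coxeter_group W -> finitely_generated W ->
      finitely_torsion_generated G -> elem_equiv W G -> is_coxeter_group G) ->
  forall n (W G : group) (S : Type) (s : S -> W) (m : S -> S -> nat) (L : list S),
    coxeter_presentation W S s m -> (forall a, In a L) -> length L <= n ->
    no_finite_normal W -> finitely_torsion_generated G -> elem_equiv W G ->
    is_coxeter_group G.
Proof.
  intros Hirr. induction n as [n IH] using lt_wf_ind.
  intros W G S s m L pres HL Hn Hno Hft HE.
  assert (Sfin : finite (fun _ : S => True)) by (exists L; auto).
  assert (Hfg : finitely_generated W).
  { destruct pres as (_ & _ & Hg & _). apply (generated_list_fg W S s Hg Sfin). }
  destruct (classic (diagram_connected S m)) as [Con|Ncon].
  { apply (Hirr W G); auto. exists S, s, m. auto. }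
  assert (HI : exists I : S -> Prop, separated W S s I /\ (exists a, I a) /\ exists b, ~ I b).
  { apply not_all_ex_not in Ncon. destruct Ncon as (a & Na).
    apply not_all_ex_not in Na. destruct Na as (b & Nb).
    (* The connected component of [a] in the diagram, which misses [b]. *)
    exists (fun b => clos_refl_trans S (fun x y => m x y <> 2) a b). split; [|split].
    - intros x y Hx Hy. assert (E : m x y = 2).
      { apply NNPP. intros E. apply Hy. apply rt_trans with x; [exact Hx|]. apply rt_step, E. }
      pose proof (s_invol W S s m pres) as Inv. destruct pres as (_ & _ & _ & Hr & _).
      specialize (Hr x y). rewrite E in Hr. simpl in Hr. rewrite gmul1r in Hr.
      apply invol_comm; auto.
    - exists a. apply rt_refl.
    - exists b. exact Nb. }
  destruct HI as (I & HI & (a & Ha) & (b & Hb)).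
  pose proof (separated_fac W S s m pres I HI) as Fac.
  pose proof Fac as (HM & HN & _).
  destruct (elem_equiv_factors W G _ _ HM HN
    (no_finite_normal_centerless W S s m pres Hno) Hfg
    (finite_factors W S s m pres Sfin Hno) Fac HE) as (M' & N' & HM' & HN' & Fac' & EM & EN).
  apply (fac_coxeter G M' N' HM' HN' Fac').
  - destruct (sig_list I L) as (L' & H1 & H2 & H3).
    assert (Hlt : length L' < length L) by (apply H3; eauto).
    apply (IH (length L')) with (2 := par_coxeter W S s m pres I HM HI) (L := L'); auto; try lia.
    + apply (fac_no_finite_normal W _ _ HM Fac). intros K K1 K2 K3 _. apply Hno; auto.
    + apply (fac_ftg G M' N' HM' Fac' Hft).
  - destruct (sig_list (fun a => ~ I a) L) as (L' & H1 & H2 & H3).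
    assert (Hlt : length L' < length L) by (apply H3; exists a; auto).
    apply (IH (length L')) with
      (2 := par_coxeter W S s m pres _ HN (separated_compl W S s I HI)) (L := L'); auto; try lia.
    + apply (fac_no_finite_normal W _ _ HN (fac_sym W _ _ Fac)).
      intros K K1 K2 K3 _. apply Hno; auto.
    + apply (fac_ftg G N' M' HN' (fac_sym G _ _ Fac') Hft).
Qed.

Theorem theorem1p4 :
  (forall W G : group,
      is_coxeter_group W -> finitely_generated W ->
      finitely_torsion_generated G -> elem_equiv W G ->
      is_coxeter_group G)
  <->
  (forall W G : group,
      is_irreducible_coxeter_group W -> finitely_generated W ->
      finitely_torsion_generated G -> elem_equiv W G ->
      is_coxeter_group G).
Proof.
  split.
  { intros H W G (S & s & m & pres & _). apply H. exists S, s, m. exact pres. }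
  intros Hirr W G (S & s & m & pres) Hfg Hft HE.
  pose proof (fg_rank_finite W S s m pres Hfg) as Sfin.
  destruct (finite_part W S s m pres Sfin) as (I & HI & Ffin & Hno).
  pose proof (separated_fac W S s m pres I HI) as Fac.
  pose proof Fac as (HM & HN & _).
  assert (Hno' : no_finite_normal (sub W (par W S s (fun a => ~ I a)) HN)).
  { apply (fac_no_finite_normal W _ _ HN (fac_sym W _ _ Fac)). exact Hno. }
  assert (HGfg : finitely_generated G) by (destruct Hft as (l & _ & Hl); exists l; exact Hl).
  destruct (elem_equiv_finite_factor W G _ _ HM HN Fac Ffin Hno') as
    (F' & R & HF' & HR & Fac' & (f & Hf & Inj & Sur) & ER); auto.
  { intros z _. apply (central_invol W S s m pres). }
  apply (fac_coxeter G F' R HF' HR Fac').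
  - apply (coxeter_iso _ _ f Hf Inj Sur).
    eexists _, _, _. apply (par_coxeter W S s m pres I HM HI).
  - destruct Sfin as (L & HL). destruct (sig_list (fun a => ~ I a) L) as (L' & H1 & _).
    apply (infinite_part_case Hirr (length L')) with
      (1 := par_coxeter W S s m pres _ HN (separated_compl W S s I HI)) (L := L'); auto.
    apply (fac_ftg G R F' HR (fac_sym G _ _ Fac') Hft).
Qed.
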